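(* Let $\{G_n\}$ be a sequence of graphs with $|V(G_n)|\to\infty$, $H$ a fixed connected graph, and $p_n\in(0,\tfrac1{20}]$, with $\sigma(H,G_n)^2>0$. Then $Z(H,G_n)\to N(0,1)$ in distribution if and only if both $$\limsup_{M\to\infty}\limsup_{n\to\infty}\big|\mathbb E[Z_M^\circ(H,G_n)^2]-1\big|=0\quad\text{and}\quad\limsup_{M\to\infty}\limsup_{n\to\infty}\big|\mathbb E[Z_M^\circ(H,G_n)^4]-3\big|=0.$$
   Context: $G_n$ is a simple, labeled, undirected graph on $V(G_n)=\{1,\dots,|V(G_n)|\}$ with adjacency matrix $(a_{ij})$; $H=(V(H),E(H))$ is connected with $V(H)=\{1,\dots,|V(H)|\}$ and $|Aut(H)|$ automorphisms. $V(G_n)_k$ is the set of $k$-tuples of distinct vertices; $\bar{\mathbf s}$ is the set of entries of $\mathbf s$. $M_H(\mathbf s)=\prod_{(i,j)\in E(H)}a_{s_is_j}$, $N(H,G_n)=\frac1{|Aut(H)|}\sum_{\mathbf s\in V(G_n)_{|V(H)|}}M_H(\mathbf s)$. $\{X_v\}$ i.i.d. Bernoulli$(p_n)$, $X_{\mathbf s}=\prod_uX_{s_u}$, $T(H,G_n)=\frac1{|Aut(H)|}\sum_{\mathbf s}M_H(\mathbf s)X_{\mathbf s}$, $\sigma(H,G_n)^2=\mathrm{Var}[T(H,G_n)]$, $Z(H,G_n)=(T(H,G_n)-p_n^{|V(H)|}N(H,G_n))/\sigma(H,G_n)$. Local count: $t_H(A)=\frac1{|Aut(H)|}\sum_{\mathbf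 s:\bar{\mathbf s}\supseteq A}M_H(\mathbf s)$ for $A\subset V(G_n)$, $|A|\le|V(H)|$. For $M>0$ let $\mathcal C_M(A)$ be the condition $t_H(A)^2>Mp_n^{2|A|-2|V(H)|}\mathrm{Var}[T(H,G_n)]$, and $\mathbf 1\{\mathcal C_M(\mathbf s)\}=1$ iff $\mathcal C_M(A)$ fails for every nonempty $A\subseteq\bar{\mathbf s}$. Set $T_M^\circ(H,G_n)=\frac1{|Aut(H)|}\sum_{\mathbf s\in V(G_n)_{|V(H)|}}M_H(\mathbf s)X_{\mathbf s}\mathbf 1\{\mathcal C_M(\mathbf s)\}$ and $Z_M^\circ(H,G_n)=(T_M^\circ(H,G_n)-\mathbb E[T_M^\circ(H,G_n)])/\sigma(H,G_n)$. *)

(* Defs.v *)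
From HB Require Import structures.
From mathcomp Require Import all_boot all_order all_algebra all_fingroup.
From mathcomp Require Import all_classical all_reals all_analysis.
Set Implicit Arguments. Unset Strict Implicit. Unset Printing Implicit Defensive.
Import Order.TTheory GRing.Theory Num.Theory.
Local Open Scope ring_scope.

Definition simple_graph (m : nat) (e : rel 'I_m) : bool :=
  [forall x, forall y, e x y == e y x] && [forall x, ~~ e x x].

Definition connected_graph (m : nat) (e : rel 'I_m) : bool :=
  [forall x, forall y, connect e x y].

Definition num_aut (k : nat) (eH : rel 'I_k) : nat :=
  #|[set sg : {perm 'I_k} | [forall i, forall j, eH (sg i) (sg j) == eH i j]]|.

Section Counts.
Variables (R : realType) (N : nat) (adj : rel 'I_N) (k : nat) (eH : rel 'I_k)
  (p : R).

Definition outcome := {ffun 'I_N -> bool}.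
Definition weight (w : outcome) : R := \prod_v (if w v then p else 1 - p).
Definition Ex (f : outcome -> R) : R := \sum_w weight w * f w.
Definition Prob (P : pred outcome) : R := \sum_(w | P w) weight w.

Definition MH (s : {ffun 'I_k -> 'I_N}) : R :=
  \prod_(ij : 'I_k * 'I_k | (ij.1 < ij.2)%N && eH ij.1 ij.2)
     (adj (s ij.1) (s ij.2))%:R.

Definition Xs (w : outcome) (s : {ffun 'I_k -> 'I_N}) : R :=
  \prod_(u : 'I_k) (w (s u))%:R.

Definition NH : R :=
  ((num_aut eH)%:R)^-1 * \sum_(s : {ffun 'I_k -> 'I_N} | injectiveb s) MH s.

Definition TH (w : outcome) : R :=
  ((num_aut eH)%:R)^-1 * \sum_(s : {ffun 'I_k -> 'I_N} | injectiveb s) MH s * Xs w s.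

Definition VarT : R := Ex (fun w => TH w ^+ 2) - (Ex TH) ^+ 2.
Definition sigmaT : R := Num.sqrt VarT.

Definition ZH (w : outcome) : R := (TH w - p ^+ k * NH) / sigmaT.

Definition tH (A : {set 'I_N}) : R :=
  ((num_aut eH)%:R)^-1 *
  \sum_(s : {ffun 'I_k -> 'I_N} | injectiveb s && (A \subset codom s)) MH s.

Definition CM (M : R) (A : {set 'I_N}) : bool :=
  M * p ^ ((2 * #|A|)%:Z - (2 * k)%:Z) * VarT < tH A ^+ 2.

Definition goodM (M : R) (s : {ffun 'I_k -> 'I_N}) : bool :=
  [forall A : {set 'I_N}, ((A != finset.set0) && (A \subset codom s)) ==> ~~ CM M A].

Definition TM (M : R) (w : outcome) : R :=
  ((num_aut eH)%:R)^-1 *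
  \sum_(s : {ffun 'I_k -> 'I_N} | injectiveb s) MH s * Xs w s * (goodM M s)%:R.

Definition ZM (M : R) (w : outcome) : R := (TM M w - Ex (TM M)) / sigmaT.

End Counts.

Definition Phi (R : realType) (t : R) : R :=
  fine (normal_prob 0 1 `]-oo, t]%classic).

(* Main.v *)
(* Normalise by sigma and write Z = sum_i m_i Y_i over the copies i of H, where
   Y_i = X_(c i) - p^|c i|, c i is the vertex set of the copy and m_i >= 0; truncation only
   discards indices i.  For p <= 1/20 every centred joint moment of four or five of the Y_i
   is nonnegative, and the fourth joint cumulant of Y_i, Y_j, Y_l, Y_h is at least
   (1 - 7p) p^|union| when the four sets are linked.  Hence E W^4 - 3 (E W^2)^2 dominates
   the sum D of m_i m_j m_l m_h p^|union| over linked quadruples, and every error term of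
   Stein's method for W = Z_M is bounded by D: convergence of the second and fourth moments
   gives normality of Z_M.  With tau(A) = p^(k-|A|) t_H(A) / sigma, the sum over A of
   p^|A| tau(A)^2 is bounded, so sets with tau(A)^2 > M are rare: Z and Z_M agree up to a
   shift O(M^(-1/2)) outside an event of probability O(1/M).

   Conversely, normality of Z gives the limiting law of Z_M, and the moments follow from a
   bound on E |Z_M|^5 that is uniform in M.  Its positive part is controlled by Z, since
   Z_M <= Z + shift, and by E Z_M^6, which is bounded in n for each fixed M; the negative
   part is controlled because E Z_M^5 >= 0. *)
Require Import Defs.
From HB Require Import structures.
From mathcomp Require Import all_boot all_order all_algebra.
From mathcomp Require Import reals ring lra.
Set Implicit Arguments.
Unset Strict Implicit.
Unset Printing Implicit Defensive.
Import Order.TTheory GRing.Theory Num.Theory.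
Local Open Scope ring_scope.

(** Normality of Z need not control its moments: a rare event on which a locally dense vertex set is
    fully selected may dominate E Z^4 and yet be invisible to the distribution function. Truncation
    removes these sets at a level M that does not depend on n, so the limits are taken along one
    filter on pairs (M, n), and the limit theorems are proved for general filters. The constant 1 -
    7p counts shared vertices. Sets that meet satisfy [q A * q B <= p * q (A :|: B)]; a fourth
    cumulant loses p four times through single factors and three times through pairs. Stein's
    remainder is of third order whereas D is of fourth order; interpolation with a free parameter a
    bounds it by a multiple of a + D / a, and D tends to 0 while a stays fixed. In the converse the
    sixth-moment bound grows with M. It is used only beyond a level k depending on M; as n grows,
    what remains above k becomes the Gaussian quantity k^5 (1 - Phi k), which is bounded uniformly
    in k. *)

Section Expectation.
Variables (R : realType) (N : nat) (p : R).
Hypothesis p01 : 0 <= p <= 1.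
Implicit Types (f g : outcome N -> R) (w : outcome N) (B : {set 'I_N}).
Local Notation E := (@Ex R N p).

Lemma weight_ge0 w : 0 <= weight p w.
Proof.
by apply: prodr_ge0 => v _; case: ifP => _; case/andP: p01 => ??; rewrite ?subr_ge0.
Qed.

Lemma eq_Ex f g : f =1 g -> E f = E g.
Proof. by move=> fg; apply: eq_bigr => w _; rewrite fg. Qed.

Lemma ExD f g : E (fun w => f w + g w) = E f + E g.
Proof. by rewrite -big_split; apply: eq_bigr => w _; rewrite mulrDr. Qed.

Lemma ExZ a f : E (fun w => a * f w) = a * E f.
Proof. by rewrite [RHS]big_distrr; apply: eq_bigr => w _; rewrite mulrCA. Qed.

Lemma ExZr a f : E (fun w => f w * a) = E f * a.
Proof. by rewrite [RHS]big_distrl; apply: eq_bigr => w _; rewrite mulrA. Qed.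

Lemma ExN f : E (fun w => - f w) = - E f.
Proof. by rewrite -mulN1r -ExZ; apply: eq_Ex => w; rewrite mulN1r. Qed.

Lemma ExB f g : E (fun w => f w - g w) = E f - E g.
Proof. by rewrite ExD ExN. Qed.

Lemma Ex_sum (J : finType) (P : pred J) (F : J -> outcome N -> R) :
  E (fun w => \sum_(j | P j) F j w) = \sum_(j | P j) E (F j).
Proof. by rewrite [RHS]exchange_big; apply: eq_bigr => w _; rewrite mulr_sumr. Qed.

Lemma Ex_cst a : E (fun=> a) = a.
Proof.
rewrite /Ex -big_distrl /= (_ : \sum_w _ = 1) ?mul1r //.
rewrite /weight -(bigA_distr_bigA (fun _ (b : bool) => if b then p else 1 - p)) big1 // => v _.
by rewrite big_bool /= addrC subrK.
Qed.

Lemma ler_Ex f g : (forall w, f w <= g w) -> E f <= E g.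
Proof. by move=> fg; apply: ler_sum => w _; rewrite ler_wpM2l ?weight_ge0. Qed.

Lemma Ex_ge0 f : (forall w, 0 <= f w) -> 0 <= E f.
Proof. by move=> f0; apply: sumr_ge0 => w _; rewrite mulr_ge0 ?weight_ge0. Qed.

Lemma normr_Ex f : `|E f| <= E (fun w => `|f w|).
Proof.
apply: (le_trans (ler_norm_sum _ _ _)); apply: ler_sum => w _.
by rewrite normrM (ger0_norm (weight_ge0 w)).
Qed.

Lemma ProbE (P : pred (outcome N)) : Prob p P = E (fun w => (P w)%:R).
Proof.
by rewrite /Prob big_mkcond; apply: eq_bigr => w _; case: (P w); rewrite ?mulr1 ?mulr0.
Qed.

Lemma ler_Prob (P Q : pred (outcome N)) : {subset P <= Q} -> Prob p P <= Prob p Q.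
Proof.
move=> PQ; rewrite !ProbE; apply: ler_Ex => w; rewrite ler_nat.
by move: (PQ w); rewrite !unfold_in; case: (P w) => // ->.
Qed.

(** This invariance encodes independence: under the product weight, a function that ignores the
    coordinates in [B] is independent of [allon B]. *)
Definition depends_off B f :=
  forall w w', (forall v, v \notin B -> w v = w' v) -> f w = f w'.

(** The product of X_v over [B]. Written as the indicator of an inclusion, it turns products into
    unions ([allonU]), which absorbs X_v^2 = X_v. *)
Definition allon B w : R := (B \subset [set v | w v])%:R.

Definition flip (v : 'I_N) w : outcome N := [ffun u => if u == v then ~~ w u else w u].

Lemma flipK v : involutive (flip v).
Proof. by move=> w; apply/ffunP => u; rewrite !ffunE; case: eqP => // _; rewrite negbK. Qed.

Lemma allonU A B w : allon (A :|: B) w = allon A w * allon B w.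
Proof. by rewrite /allon subUset -mulnb natrM. Qed.

Lemma allon0 w : allon set0 w = 1.
Proof. by rewrite /allon sub0set. Qed.

Lemma allon_ge0 A w : 0 <= allon A w.
Proof. exact: ler0n. Qed.

(** Flipping [v] matches the outcomes with [v] off to those with [v] on and preserves both [f] and
    the weight [r] of the other coordinates, so the two halves of [E f] carry the shares p and 1 -
    p. *)
Lemma Ex_coord v f : depends_off [set v] f ->
  E (fun w => (w v)%:R * f w) = p * E f.
Proof.
move=> fv; pose r w : R := \prod_(u | u != v) (if w u then p else 1 - p).
have wE w : weight p w = (if w v then p else 1 - p) * r w by rewrite /weight (bigD1 v).
have rf w : r (flip v w) = r w.
  by apply: eq_bigr => u uv; rewrite ffunE (negPf uv).
have ff w : f (flip v w) = f w.
  by apply: fv => u; rewrite inE ffunE => /negPf->.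
have S : \sum_(w : outcome N | ~~ w v) r w * f w = \sum_(w : outcome N | w v) r w * f w.
  rewrite (reindex_inj (inv_inj (flipK v))); apply: eq_big => w.
    by rewrite ffunE eqxx negbK.
  by rewrite rf ff.
rewrite /Ex (bigID (fun w : outcome N => w v)) /= [X in _ + X]big1 ?addr0; last first.
  by move=> w /negPf->; rewrite mul0r mulr0.
rewrite [in RHS](bigID (fun w : outcome N => w v)) /=.
under eq_bigr => w wv do rewrite wE wv mul1r -mulrA.
rewrite -big_distrr /=; congr (_ * _).
under [X in _ = X + _]eq_bigr => w wv do rewrite wE wv -mulrA.
under [X in _ = _ + X]eq_bigr => w /negPf wv do rewrite wE wv -mulrA.
by rewrite -!big_distrr /= S; ring.
Qed.

Lemma Ex_allonM B f : depends_off B f ->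
  E (fun w => allon B w * f w) = p ^+ #|B| * E f.
Proof.
elim: {B}#|B| {-2}B (erefl #|B|) f => [|n IHn] B cB f fB.
  by rewrite (cards0_eq cB) cards0 mul1r; apply: eq_Ex => w; rewrite allon0 mul1r.
have [v vB] : exists v, v \in B by apply/card_gt0P; rewrite cB.
have cB' : #|B :\ v| = n by move: (cardsD1 v B); rewrite vB cB => -[].
transitivity (E (fun w => (w v)%:R * (allon (B :\ v) w * f w))).
  apply: eq_Ex => w; rewrite mulrA; congr (_ * _).
  by rewrite -{1}(setD1K vB) allonU /allon sub1set inE.
rewrite Ex_coord; first last.
  move=> w w' ww'; congr (_ * _); last first.
    by apply: fB => u uB; apply: ww'; rewrite inE; apply: contraNneq uB => ->.
  rewrite /allon; congr (nat_of_bool _)%:R; apply/subsetP/subsetP => sub u uB;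
    by move: (sub u uB); rewrite !inE ww' // inE; case/setD1P: uB.
rewrite IHn //; first by rewrite mulrA cB' cB -exprS.
move=> w w' ww'; apply: fB => u uB; by apply: ww'; rewrite inE negb_and uB orbT.
Qed.

Lemma Ex_allon B : E (allon B) = p ^+ #|B|.
Proof.
by rewrite -[RHS]mulr1 -[X in _ * X]Ex_cst -Ex_allonM //; apply: eq_Ex => w; rewrite mulr1.
Qed.

Lemma depends_off_allon (A B : {set _}) : [disjoint A & B] -> depends_off A (allon B).
Proof.
move=> dAB w w' ww'; congr (nat_of_bool _)%:R.
by apply/subsetP/subsetP => sub u uB; move: (sub u uB);
  rewrite !inE ww' //; apply: contraL uB => /(disjointFr dAB)->.
Qed.

End Expectation.

(** * Joint moments of centred indicators of vertex sets *)

Section CenteredMoments.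
Variables (R : realType) (N : nat) (p : R) (I : finType) (c : I -> {set 'I_N}).
Hypothesis p_small : 0 < p <= 1 / 20.
Local Notation E := (@Ex R N p).
Implicit Types (A B : {set 'I_N}) (i j l h : I) (s : seq I).

Let p01 : 0 <= p <= 1. Proof. by case/andP: p_small => ??; apply/andP; split; lra. Qed.
Let p_ge0 : 0 <= p. Proof. by case/andP: p01. Qed.
Let p_le1 : p <= 1. Proof. by case/andP: p01. Qed.

Definition q B : R := p ^+ #|B|.

Lemma q_ge0 B : 0 <= q B. Proof. exact: exprn_ge0. Qed.
Lemma q_gt0 B : 0 < q B. Proof. by apply: exprn_gt0; case/andP: p_small. Qed.
Lemma q_le1 B : q B <= 1. Proof. exact: exprn_ile1. Qed.
Lemma q_set0 : q set0 = 1. Proof. by rewrite /q cards0. Qed.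

Lemma qUI A B : q A * q B = q (A :|: B) * q (A :&: B).
Proof. by rewrite /q -!exprD -cardsUI addnC. Qed.

Lemma qM_le A B : q A * q B <= q (A :|: B).
Proof. by rewrite qUI ler_piMr ?q_ge0 ?q_le1. Qed.

(** By [qUI] the ratio of the two sides without p is [q (A :&: B)], and a common vertex makes this
    at most p. The constants 1 - p, 1 - 4p, 1 - 5p and 1 - 7p below count uses of this bound. *)
Lemma qM_meet A B : A :&: B != set0 -> q A * q B <= p * q (A :|: B).
Proof.
rewrite -card_gt0 => AB; rewrite qUI mulrC ler_wpM2r ?q_ge0 // /q.
by rewrite -(prednK AB) exprS ler_piMr // exprn_ile1.
Qed.

(** The union is a free [U], so that differently bracketed unions share one atom [q U] in linear
    arithmetic. *)
Lemma qM_meet_eq A B : A :&: B != set0 ->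
  forall U, A :|: B = U -> q A * q B <= p * q U.
Proof. by move=> AB U <-; apply: qM_meet. Qed.

Lemma qM_disj A B : A :&: B = set0 -> q A * q B = q (A :|: B).
Proof. by move=> AB; rewrite qUI AB q_set0 mulr1. Qed.

Lemma q_subset A B : A \subset B -> q B <= q A.
Proof. by move=> AB; apply: ler_wiXn2l; rewrite ?subset_leq_card. Qed.

Definition centered i (w : outcome N) : R := allon R (c i) w - q (c i).

(** [B] collects the sets of the factors already multiplied out; with it, [moment_cons] and
    [moment_nil] turn every concrete joint moment into a polynomial in values of [q]. *)
Definition moment B s := E (fun w => allon R B w * \prod_(i <- s) centered i w).

Definition coverage s := \bigcup_(i <- s) c i.

Lemma coverage_cons i s : coverage (i :: s) = c i :|: coverage s.
Proof. by rewrite /coverage big_cons. Qed.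

Lemma coverage_nil : coverage [::] = set0. Proof. by rewrite /coverage big_nil. Qed.

Lemma moment_nil B : moment B [::] = q B.
Proof.
rewrite /q -Ex_allon; apply: eq_Ex => w; by rewrite big_nil mulr1.
Qed.

Lemma moment_cons B i s :
  moment B (i :: s) = moment (B :|: c i) s - q (c i) * moment B s.
Proof.
rewrite -ExZ -ExB; apply: eq_Ex => w; rewrite big_cons allonU /centered; ring.
Qed.

Lemma moment_perm B s t : perm_eq s t -> moment B s = moment B t.
Proof. by move=> st; apply: eq_Ex => w; rewrite (perm_big _ st). Qed.

Lemma depends_off_centered A i : [disjoint A & c i] -> depends_off A (centered i).
Proof. by move=> dA w w' ww'; rewrite /centered (depends_off_allon R dA ww'). Qed.

Lemma depends_off_prod A s : [disjoint A & coverage s] ->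
  depends_off A (fun w => \prod_(i <- s) centered i w).
Proof.
move=> dA w w' ww'; rewrite !big_seq; apply: eq_bigr => i si.
apply: depends_off_centered ww'; apply: disjointWr dA.
by rewrite /coverage (big_rem _ si) subsetUl.
Qed.

Lemma Ex_allon_indep B (f : outcome N -> R) : depends_off B f ->
  E (fun w => allon R B w * f w) = q B * E f.
Proof. exact: Ex_allonM. Qed.

Lemma Ex_centered i (f : outcome N -> R) : depends_off (c i) f ->
  E (fun w => centered i w * f w) = 0.
Proof.
move=> fi; under eq_Ex => w do rewrite mulrBl.
by rewrite ExB ExZ Ex_allon_indep // subrr.
Qed.

(** The isolated factor has mean zero and is independent of the product of the others. *)
Lemma moment_isolated i s : c i :&: coverage s = set0 -> moment set0 (i :: s) = 0.
Proof.
move/eqP; rewrite setI_eq0 /moment => d.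
under eq_Ex => w do rewrite allon0 mul1r big_cons.
exact/Ex_centered/depends_off_prod.
Qed.

Lemma normr_centered i w : `|centered i w| <= allon R (c i) w + q (c i).
Proof.
rewrite (le_trans (ler_normB _ _)) // !ger0_norm ?q_ge0 //; exact: allon_ge0.
Qed.

(** Each |Y_i| is at most X_(c i) + q(c i). Multiplying out gives [2 ^+ size s] terms, and each has
    expectation at most [q (coverage s)] because [qM_le] allows sets to be merged. *)
Lemma Ex_prod_norm_centered s :
  E (fun w => \prod_(i <- s) `|centered i w|) <= 2 ^+ size s * q (coverage s).
Proof.
have H B : E (fun w => allon R B w * \prod_(i <- s) (allon R (c i) w + q (c i)))
    <= 2 ^+ size s * q (B :|: coverage s).
  elim: s B => [|i s IHs] B.
    under eq_Ex => w do rewrite big_nil mulr1.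
    by rewrite Ex_allon coverage_nil setU0 mul1r lexx.
  have -> : E (fun w => allon R B w * \prod_(j <- i :: s) (allon R (c j) w + q (c j))) =
    E (fun w => allon R (B :|: c i) w * \prod_(j <- s) (allon R (c j) w + q (c j))) +
    q (c i) * E (fun w => allon R B w * \prod_(j <- s) (allon R (c j) w + q (c j))).
    by rewrite -ExZ -ExD; apply: eq_Ex => w; rewrite big_cons allonU; ring.
  rewrite coverage_cons setUA /= exprS -mulrA mulrDl mul1r lerD ?IHs //.
  apply: le_trans (ler_wpM2l (q_ge0 _) (IHs _)) _.
  by rewrite mulrCA ler_wpM2l ?exprn_ge0 // (le_trans (qM_le _ _)) // setUCA setUA.
have := H set0; rewrite set0U; apply: le_trans; apply: (ler_Ex p01) => w.
rewrite allon0 mul1r; elim: s {H} => [|i s IHs]; first by rewrite !big_nil.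
by rewrite !big_cons ler_pM ?normr_centered ?prodr_ge0.
Qed.

Lemma moment_norm_le s : `|moment set0 s| <= 2 ^+ size s * q (coverage s).
Proof.
apply: le_trans (Ex_prod_norm_centered s); apply: le_trans (normr_Ex p01 _) _.
by apply: (ler_Ex p01) => w; rewrite allon0 mul1r normr_prod.
Qed.

Ltac setcase := by apply/setP => ?; rewrite !inE; do !case: (_ \in _).

Definition moment2 i j := moment set0 [:: i; j].
Definition moment4 i j l h := moment set0 [:: i; j; l; h].
Definition moment5 i j l h g := moment set0 [:: i; j; l; h; g].

Lemma moment2E i j : moment2 i j = q (c i :|: c j) - q (c i) * q (c j).
Proof. by rewrite /moment2 !(moment_cons, moment_nil) !set0U q_set0; ring. Qed.

Lemma moment2_disj i j : c i :&: c j = set0 -> moment2 i j = 0.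
Proof. by rewrite moment2E => /qM_disj->; rewrite subrr. Qed.

Lemma moment2_meet i j : c i :&: c j != set0 -> (1 - p) * q (c i :|: c j) <= moment2 i j.
Proof. by rewrite moment2E => /qM_meet; lra. Qed.

Lemma moment2_le i j : moment2 i j <= q (c i :|: c j).
Proof. by rewrite moment2E; have := q_ge0 (c i); have := q_ge0 (c j); nra. Qed.

Lemma moment2_ge0 i j : 0 <= moment2 i j.
Proof. by rewrite moment2E subr_ge0 qM_le. Qed.

(** In the expansion the four terms with one factor replaced by its mean cost at most p [q U] each,
    by the hypotheses. The product of all four values of [q] has coefficient -4 + 1 = -3. *)
Lemma moment4_ge i j l h :
  c i :&: (c j :|: c l :|: c h) != set0 -> c j :&: (c i :|: c l :|: c h) != set0 ->
  c l :&: (c i :|: c j :|: c h) != set0 -> c h :&: (c i :|: c j :|: c l) != set0 ->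
  (1 - 4 * p) * q (c i :|: c j :|: c l :|: c h) <= moment4 i j l h.
Proof.
rewrite /moment4 !(moment_cons, moment_nil) !set0U q_set0.
set U := c i :|: c j :|: c l :|: c h.
move=> /qM_meet_eq /(_ U ltac:(setcase)) Hi.
move=> /qM_meet_eq /(_ U ltac:(setcase)) Hj.
move=> /qM_meet_eq /(_ U ltac:(setcase)) Hl.
move=> /qM_meet_eq /(_ U ltac:(setcase)) Hh.
(* Three of the six positive pair terms absorb -3 times the full product; the other three are only
   needed to be nonnegative. *)
have Hij := ler_wpM2r (mulr_ge0 (q_ge0 (c l)) (q_ge0 (c h))) (qM_le (c i) (c j)).
have Hil := ler_wpM2r (mulr_ge0 (q_ge0 (c j)) (q_ge0 (c h))) (qM_le (c i) (c l)).
have Hih := ler_wpM2r (mulr_ge0 (q_ge0 (c j)) (q_ge0 (c l))) (qM_le (c i) (c h)).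
have Pjl := mulr_ge0 (mulr_ge0 (q_ge0 (c i)) (q_ge0 (c h))) (q_ge0 (c j :|: c l)).
have Pjh := mulr_ge0 (mulr_ge0 (q_ge0 (c i)) (q_ge0 (c l))) (q_ge0 (c j :|: c h)).
have Plh := mulr_ge0 (mulr_ge0 (q_ge0 (c i)) (q_ge0 (c j))) (q_ge0 (c l :|: c h)).
lra.
Qed.

(** Again each of the five terms with one factor replaced by its mean costs p [q U]. The product of
    all five values of [q] now has coefficient 5 - 1 = 4, so its sign is favourable. *)
Lemma moment5_ge i j l h g :
  c i :&: (c j :|: c l :|: c h :|: c g) != set0 ->
  c j :&: (c i :|: c l :|: c h :|: c g) != set0 ->
  c l :&: (c i :|: c j :|: c h :|: c g) != set0 ->
  c h :&: (c i :|: c j :|: c l :|: c g) != set0 ->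
  c g :&: (c i :|: c j :|: c l :|: c h) != set0 ->
  (1 - 5 * p) * q (c i :|: c j :|: c l :|: c h :|: c g) <= moment5 i j l h g.
Proof.
rewrite /moment5 !(moment_cons, moment_nil) !set0U q_set0.
set U := c i :|: c j :|: c l :|: c h :|: c g.
move=> /qM_meet_eq /(_ U ltac:(setcase)) Hi.
move=> /qM_meet_eq /(_ U ltac:(setcase)) Hj.
move=> /qM_meet_eq /(_ U ltac:(setcase)) Hl.
move=> /qM_meet_eq /(_ U ltac:(setcase)) Hh.
move=> /qM_meet_eq /(_ U ltac:(setcase)) Hg.
(* each of the ten negative terms, in which two of the five sets are merged, is absorbed by
   a positive one in which three are *)
have T a b x y z V : V = x :|: (y :|: z) ->
    q (c a) * q (c b) * (q x * q (y :|: z)) <= q (c a) * q (c b) * q V.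
  by move=> ->; rewrite ler_wpM2l ?mulr_ge0 ?q_ge0 ?qM_le.
(* Pairs and triples are matched bijectively, compatibly with the rotation i, j, l, h, g: a pair of
   neighbours such as i, j gains its successor l, and a pair at distance two such as i, l gains the
   predecessor g of i. *)
have T1 := T h g (c l) (c i) (c j) (c i :|: c j :|: c l) ltac:(setcase).
have T2 := T i g (c h) (c j) (c l) (c j :|: c l :|: c h) ltac:(setcase).
have T3 := T i j (c g) (c l) (c h) (c l :|: c h :|: c g) ltac:(setcase).
have T4 := T j l (c i) (c h) (c g) (c i :|: c h :|: c g) ltac:(setcase).
have T5 := T l h (c j) (c i) (c g) (c i :|: c j :|: c g) ltac:(setcase).
have T6 := T j h (c g) (c i) (c l) (c i :|: c l :|: c g) ltac:(setcase).
have T7 := T l g (c i) (c j) (c h) (c i :|: c j :|: c h) ltac:(setcase).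
have T8 := T i h (c j) (c l) (c g) (c j :|: c l :|: c g) ltac:(setcase).
have T9 := T j g (c l) (c i) (c h) (c i :|: c l :|: c h) ltac:(setcase).
have T10 := T i l (c h) (c j) (c g) (c j :|: c h :|: c g) ltac:(setcase).
have P := mulr_ge0 (mulr_ge0 (mulr_ge0 (mulr_ge0 (q_ge0 (c i)) (q_ge0 (c j))) (q_ge0 (c l)))
  (q_ge0 (c h))) (q_ge0 (c g)).
lra.
Qed.

End CenteredMoments.

(** * Lower bounds for fourth cumulants and fifth moments *)

Section FourthCumulant.
Variables (R : realType) (N : nat) (p : R) (I : finType) (c : I -> {set 'I_N}).
Hypothesis p_small : 0 < p <= 1 / 20.
Local Notation E := (@Ex R N p).
Local Notation q := (@q R N p).
Local Notation centered := (centered p c).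
Local Notation moment := (moment p c).
Local Notation moment2 := (moment2 p c).
Local Notation moment4 := (moment4 p c).
Local Notation moment5 := (moment5 p c).
Implicit Types (A B : {set 'I_N}) (i j l h : I) (s : seq I).

Let p01 : 0 <= p <= 1. Proof. by case/andP: p_small => ??; apply/andP; split; lra. Qed.

Definition meet A B := A :&: B != set0.

(* No block of a nontrivial partition of the four sets is disjoint from the rest. *)
Definition linked4 i j l h : bool :=
  [&& meet (c i) (c j :|: c l :|: c h), meet (c j) (c i :|: c l :|: c h),
      meet (c l) (c i :|: c j :|: c h), meet (c h) (c i :|: c j :|: c l),
      meet (c i :|: c j) (c l :|: c h), meet (c i :|: c l) (c j :|: c h)
    & meet (c i :|: c h) (c j :|: c l)].

Definition support4 i j l h := c i :|: c j :|: c l :|: c h.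

Lemma moment_indep B s : B :&: coverage c s = set0 ->
  moment B s = q B * moment set0 s.
Proof.
move=> /eqP; rewrite setI_eq0 => d; rewrite /moment.
under [in RHS]eq_Ex => w do rewrite allon0 mul1r.
by apply: Ex_allon_indep; apply: depends_off_prod.
Qed.

(** Expanding the first two factors leaves moments of [[:: l; h]] over subsets of [c i :|: c j], and
    these split off by [moment_indep]. *)
Lemma moment4_split i j l h : (c i :|: c j) :&: (c l :|: c h) = set0 ->
  moment4 i j l h = moment2 i j * moment2 l h.
Proof.
move=> d; have sub B : B \subset c i :|: c j -> B :&: coverage c [:: l; h] = set0.
  move=> sB; apply/eqP; rewrite -subset0 -d.
  by rewrite !coverage_cons coverage_nil setU0 setSI.
rewrite /moment4 [LHS]moment_cons ![in LHS](moment_cons p c _ j) !set0U.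
rewrite (moment_indep (sub _ (subxx _))) (moment_indep (sub _ (subsetUl _ _))).
rewrite (moment_indep (sub _ (subsetUr _ _))).
by rewrite moment2E /moment2; ring.
Qed.

(** The right side is the joint cumulant of centred variables, which vanishes when the four split
    into two independent blocks. The case analysis runs through the four singletons and three
    pairings that can cause such a split. *)
Lemma cumulant4_ge i j l h :
  (linked4 i j l h)%:R * ((1 - 7 * p) * q (support4 i j l h)) <=
  moment4 i j l h - (moment2 i j * moment2 l h + moment2 i l * moment2 j h +
                     moment2 i h * moment2 j l).
Proof.
have m2C a b : moment2 a b = moment2 b a.
  by apply: moment_perm; rewrite (perm_catC [:: a] [:: b]).
have iso a b : forall S, ~~ meet (c a) S -> c b \subset S -> moment2 a b = 0.
  move=> S; rewrite negbK => /eqP d sb; apply: moment2_disj; apply/eqP.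
  by rewrite -subset0 -d setIS.
have iso4 a b e d : ~~ meet (c a) (c b :|: c e :|: c d) -> moment4 a b e d = 0.
  rewrite negbK => /eqP H; apply: moment_isolated => //.
  by rewrite !coverage_cons coverage_nil setU0 setUA.
have sub1 (A B C : {set 'I_N}) : A \subset A :|: B :|: C by rewrite -setUA subsetUl.
have sub2 (A B C : {set 'I_N}) : B \subset A :|: B :|: C by rewrite setUAC subsetUr.
have sub3 (A B C : {set 'I_N}) : C \subset A :|: B :|: C by rewrite subsetUr.
have perm a b e d : perm_eq [:: i; j; l; h] [:: a; b; e; d] ->
  moment4 i j l h = moment4 a b e d by apply: moment_perm.
rewrite /linked4.
have [Hi|Hi] /= := boolP (meet (c i) _); last first.
  by rewrite iso4 // !(iso i _ _ Hi) //; lra.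
have [Hj|Hj] /= := boolP (meet (c j) _); last first.
  rewrite (perm j i l h) ?iso4 // ?(m2C i j) ?(iso j _ _ Hj) //; first by lra.
  by rewrite (perm_catCA [:: i] [:: j]).
have [Hl|Hl] /= := boolP (meet (c l) _); last first.
  rewrite (perm l i j h) ?iso4 // ?(m2C i l) ?(m2C j l) ?(iso l _ _ Hl) //; first by lra.
  by rewrite (perm_catCA [:: i; j] [:: l]).
have [Hh|Hh] /= := boolP (meet (c h) _); last first.
  rewrite (perm h i j l) ?iso4 // ?(m2C i h) ?(m2C j h) ?(m2C l h) ?(iso h _ _ Hh) //.
    by lra.
  by rewrite (perm_catC [:: i; j; l] [:: h]).
(* If two pairs separate, the fourth moment equals one of the three products, and the other two
   products contain a covariance across the gap. *)
have cross A B C S a b : ~~ meet (A :|: B) (C :|: S) -> c a \subset A :|: B ->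
   c b \subset C :|: S -> moment2 a b = 0.
  rewrite negbK => /eqP d sa sb; apply: moment2_disj; apply/eqP.
  by rewrite -subset0 -d setISS.
have [Hij|Hij] /= := boolP (meet (c i :|: c j) _); last first.
  rewrite moment4_split; last by apply/eqP; rewrite negbK in Hij.
  rewrite (cross _ _ _ _ i l Hij) ?(cross _ _ _ _ i h Hij) ?subsetUl ?subsetUr //; lra.
have [Hil|Hil] /= := boolP (meet (c i :|: c l) _); last first.
  rewrite (perm i l j h); last by rewrite perm_cons (perm_catCA [:: j] [:: l]).
  rewrite moment4_split; last by apply/eqP; rewrite negbK in Hil.
  rewrite (cross _ _ _ _ i j Hil) ?(cross _ _ _ _ i h Hil) ?subsetUl ?subsetUr //; lra.
have [Hih|Hih] /= := boolP (meet (c i :|: c h) _); last first.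
  rewrite (perm i h j l); last by rewrite perm_cons (perm_catC [:: j; l] [:: h]).
  rewrite moment4_split; last by apply/eqP; rewrite negbK in Hih.
  rewrite (cross _ _ _ _ i j Hih) ?(cross _ _ _ _ i l Hih) ?subsetUl ?subsetUr //; lra.
have := moment4_ge p_small Hi Hj Hl Hh.
(* For linked sets each product of covariances is at most [q] of one union times [q] of the other,
   and these unions meet. The three products cost 3p and lower 1 - 4p to 1 - 7p. *)
have pair a b e d : meet (c a :|: c b) (c e :|: c d) ->
    c a :|: c b :|: (c e :|: c d) = support4 i j l h ->
    moment2 a b * moment2 e d <= p * q (support4 i j l h).
  move=> m U; apply: le_trans (qM_meet_eq p_small m U).
  by apply: ler_pM; rewrite ?moment2_ge0 ?moment2_le.
have Uil : c i :|: c l :|: (c j :|: c h) = support4 i j l h.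
  by apply/setP => ?; rewrite !inE; do !case: (_ \in _).
have Uih : c i :|: c h :|: (c j :|: c l) = support4 i j l h.
  by apply/setP => ?; rewrite !inE; do !case: (_ \in _).
have := pair _ _ _ _ Hij (setUA _ _ _).
by have := pair _ _ _ _ Hil Uil; have := pair _ _ _ _ Hih Uih; rewrite /support4; lra.
Qed.

(** The moment vanishes if one set misses the other four, and otherwise [moment5_ge] applies. A
    split into a pair and a triple needs no separate case, since nothing is subtracted from the
    moment. *)
Lemma moment5_ge0 i j l h g : 0 <= moment5 i j l h g.
Proof.
have iso a s : perm_eq [:: i; j; l; h; g] (a :: s) -> c a :&: coverage c s = set0 ->
    0 <= moment5 i j l h g.
  by move=> P /(moment_isolated p) Z; rewrite /moment5 (moment_perm p c _ P) Z.
have sE a b d e : coverage c [:: a; b; d; e] = c a :|: c b :|: c d :|: c e.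
  by rewrite !coverage_cons coverage_nil setU0 !setUA.
have [|Hi] := eqVneq (c i :&: (c j :|: c l :|: c h :|: c g)) set0.
  by rewrite -sE; apply: iso.
have [|Hj] := eqVneq (c j :&: (c i :|: c l :|: c h :|: c g)) set0.
  by rewrite -sE; apply: iso; rewrite (perm_catCA [:: i] [:: j]).
have [|Hl] := eqVneq (c l :&: (c i :|: c j :|: c h :|: c g)) set0.
  by rewrite -sE; apply: iso; rewrite (perm_catCA [:: i; j] [:: l]).
have [|Hh] := eqVneq (c h :&: (c i :|: c j :|: c l :|: c g)) set0.
  by rewrite -sE; apply: iso; rewrite (perm_catCA [:: i; j; l] [:: h]).
have [|Hg] := eqVneq (c g :&: (c i :|: c j :|: c l :|: c h)) set0.
  by rewrite -sE; apply: iso; rewrite (perm_catC [:: i; j; l; h] [:: g]).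
apply: le_trans (moment5_ge p_small Hi Hj Hl Hh Hg).
by rewrite mulr_ge0 ?q_ge0 //; case/andP: p_small; lra.
Qed.

End FourthCumulant.

(** * Sums with nonnegative weights *)

Section WeightedSums.
Variables (R : realType) (I : finType) (m : I -> R).
Hypothesis m_ge0 : forall i, 0 <= m i.

Definition wsum (f : I -> R) : R := \sum_i m i * f i.

Lemma eq_wsum f g : f =1 g -> wsum f = wsum g.
Proof. by move=> fg; apply: eq_bigr => i _; rewrite fg. Qed.

Lemma ler_wsum f g : (forall i, f i <= g i) -> wsum f <= wsum g.
Proof. by move=> fg; apply: ler_sum => i _; rewrite ler_wpM2l. Qed.

Lemma wsum_ge0 f : (forall i, 0 <= f i) -> 0 <= wsum f.
Proof. by move=> f0; apply: sumr_ge0 => i _; rewrite mulr_ge0. Qed.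

Lemma wsumD f g : wsum (fun i => f i + g i) = wsum f + wsum g.
Proof. by rewrite -big_split; apply: eq_bigr => i _; rewrite mulrDr. Qed.

Lemma wsumZ a f : wsum (fun i => a * f i) = a * wsum f.
Proof. by rewrite mulr_sumr; apply: eq_bigr => i _; rewrite mulrCA. Qed.

Lemma wsumZr a f : wsum (fun i => f i * a) = wsum f * a.
Proof. by rewrite mulr_suml; apply: eq_bigr => i _; rewrite mulrA. Qed.

Lemma wsumN f : wsum (fun i => - f i) = - wsum f.
Proof. by rewrite -sumrN; apply: eq_bigr => i _; rewrite mulrN. Qed.

Lemma wsumB f g : wsum (fun i => f i - g i) = wsum f - wsum g.
Proof. by rewrite wsumD wsumN. Qed.

Lemma normr_wsum f : `|wsum f| <= wsum (fun i => `|f i|).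
Proof.
apply: (le_trans (ler_norm_sum _ _ _)); apply: ler_sum => i _.
by rewrite normrM ger0_norm.
Qed.

Lemma wsumC f : wsum (fun i => wsum (f i)) = wsum (fun j => wsum (f^~ j)).
Proof.
rewrite /wsum; under eq_bigr do rewrite mulr_sumr.
under [RHS]eq_bigr do rewrite mulr_sumr.
by rewrite exchange_big; do 2!apply: eq_bigr => ? _; rewrite mulrCA.
Qed.

End WeightedSums.

(** * Stein's method under local dependence *)

Section SteinBound.
Variables (R : realType) (N : nat) (p : R) (I : finType) (c : I -> {set 'I_N}).
Variable m : I -> R.
Hypothesis p_small : 0 < p <= 1 / 20.
Hypothesis m_ge0 : forall i, 0 <= m i.
Local Notation E := (@Ex R N p).
Local Notation q := (@q R N p).
Local Notation S := (wsum m).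
Local Notation centered := (centered p c).
Local Notation moment := (moment p c).
Local Notation moment2 := (moment2 p c).
Local Notation moment4 := (moment4 p c).
Local Notation linked4 := (linked4 c).
Local Notation support4 := (support4 c).
Implicit Types (i j l h : I) (s : seq I).

Let p01 : 0 <= p <= 1. Proof. by case/andP: p_small => ??; apply/andP; split; lra. Qed.

Definition csum (w : outcome N) : R := S (fun i => centered i w).
Local Notation W := csum.

Definition csum_var := E (fun w => W w ^+ 2).
Definition linked_mass :=
  S (fun i => S (fun j => S (fun l => S (fun h =>
    (linked4 i j l h)%:R * q (support4 i j l h))))).
Local Notation v := csum_var.
Local Notation D := linked_mass.

Lemma Ex_wsum (f : I -> outcome N -> R) : E (fun w => S (f^~ w)) = S (fun i => E (f i)).
Proof. by rewrite Ex_sum; apply: eq_bigr => i _; rewrite ExZ. Qed.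

(** One factor of the power is traded for one weighted sum; iteration from the empty list gives E
    W^n as an n-fold sum of joint moments. [rcons] keeps the indices in the order of the nested
    sums. *)
Lemma Ex_csumX n s : E (fun w => W w ^+ n.+1 * \prod_(i <- s) centered i w) =
  S (fun i => E (fun w => W w ^+ n * \prod_(j <- rcons s i) centered j w)).
Proof.
rewrite -Ex_wsum; apply: eq_Ex => w; rewrite exprS {1}/W -mulrA mulrC -wsumZ.
by apply: eq_wsum => i; rewrite -cats1 big_cat big_seq1 /=; ring.
Qed.

Lemma Ex_csumX0 s : E (fun w => W w ^+ 0 * \prod_(i <- s) centered i w) = moment set0 s.
Proof. by apply: eq_Ex => w; rewrite allon0. Qed.

Lemma Ex_csum_nil n :
  E (fun w => W w ^+ n) = E (fun w => W w ^+ n * \prod_(i <- [::]) centered i w).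
Proof. by apply: eq_Ex => w; rewrite big_nil mulr1. Qed.

Lemma csum_varE : v = S (fun i => S (fun j => moment2 i j)).
Proof.
rewrite /v Ex_csum_nil Ex_csumX; apply: eq_wsum => i.
by rewrite Ex_csumX; apply: eq_wsum => j; rewrite Ex_csumX0.
Qed.

Lemma Ex_csum4 : E (fun w => W w ^+ 4) =
  S (fun i => S (fun j => S (fun l => S (fun h => moment4 i j l h)))).
Proof.
rewrite Ex_csum_nil; do 4!(rewrite Ex_csumX; apply: eq_wsum => ?).
by rewrite Ex_csumX0.
Qed.

Lemma Ex_csum5_ge0 : 0 <= E (fun w => W w ^+ 5).
Proof.
rewrite Ex_csum_nil; do 5!(rewrite Ex_csumX; apply: wsum_ge0 => // ?).
by rewrite Ex_csumX0 moment5_ge0.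
Qed.

Lemma linked_mass_ge0 : 0 <= D.
Proof. by do 4!(apply: wsum_ge0 => // ?); rewrite mulr_ge0 ?q_ge0. Qed.

Lemma wsumM f g : S f * S g = S (fun i => S (fun j => f i * g j)).
Proof. by rewrite -wsumZr; apply: eq_wsum => i; rewrite wsumZ. Qed.

Lemma wsum2M f g : S (fun i => S (f i)) * S (fun i => S (g i)) =
  S (fun i => S (fun j => S (fun l => S (fun h => f i j * g l h)))).
Proof.
rewrite -wsumZr; apply: eq_wsum => i; rewrite -wsumZr; apply: eq_wsum => j.
by rewrite -wsumZ; apply: eq_wsum => l; rewrite wsumZ.
Qed.

(** The right side is the weighted sum of all fourth cumulants, to which [cumulant4_ge] applies term
    by term. *)
Lemma linked_mass_le : (1 - 7 * p) * D <= E (fun w => W w ^+ 4) - 3 * v ^+ 2.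
Proof.
(* The square of the variance is written once for each of the three pairings, by exchanging sums, so
   that all terms stand under the same four nested sums. *)
have v1 : v ^+ 2 = S (fun i => S (fun j => S (fun l => S (fun h =>
    moment2 i j * moment2 l h)))).
  by rewrite expr2 csum_varE wsum2M.
have v2 : v ^+ 2 = S (fun i => S (fun j => S (fun l => S (fun h =>
    moment2 i l * moment2 j h)))).
  by rewrite v1; apply: eq_wsum => i; rewrite wsumC.
have v3 : v ^+ 2 = S (fun i => S (fun j => S (fun l => S (fun h =>
    moment2 i h * moment2 j l)))).
  by rewrite v2; apply: eq_wsum => i; apply: eq_wsum => j; rewrite wsumC.
have -> : 3 * v ^+ 2 = v ^+ 2 + v ^+ 2 + v ^+ 2 by ring.
rewrite {1}v1 {1}v2 v3 Ex_csum4 -wsumZ -!wsumD -wsumB; apply: ler_wsum => // i.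
rewrite -wsumZ -!wsumD -wsumB; apply: ler_wsum => // j.
rewrite -wsumZ -!wsumD -wsumB; apply: ler_wsum => // l.
rewrite -wsumZ -!wsumD -wsumB; apply: ler_wsum => // h.
by rewrite mulrCA; apply: cumulant4_ge.
Qed.

Definition meeting_mass := S (fun i => S (fun j =>
  (meet (c i) (c j))%:R * q (c i :|: c j))).

(** Covariances are nonnegative, and those of meeting sets are at least (1 - p) [q] of the union, so
    the variance controls the absolute second-order sums. *)
Lemma meeting_mass_le : (1 - p) * meeting_mass <= v.
Proof.
rewrite csum_varE -wsumZ; apply: ler_wsum => // i; rewrite -wsumZ; apply: ler_wsum => // j.
rewrite mulrCA; have [H|_] := boolP (meet _ _); first by rewrite mul1r moment2_meet.
by rewrite mul0r moment2_ge0.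
Qed.

(** The part of [W] that depends on [centered i]: the difference of the two reads only vertices
    outside [c i]. *)
Definition local_sum i w : R := S (fun j => (meet (c i) (c j))%:R * centered j w).

Let absloc i w : R := S (fun j => (meet (c i) (c j))%:R * `|centered j w|).

Let absloc_ge0 i w : 0 <= absloc i w.
Proof. by apply: wsum_ge0 => // j; rewrite mulr_ge0. Qed.

Lemma normr_local_sum i w : `|local_sum i w| <= absloc i w.
Proof.
apply: le_trans (normr_wsum m_ge0 _) _; apply: ler_wsum => // j.
by rewrite normrM ger0_norm.
Qed.

Let support4E i j l h : coverage c [:: i; j; l; h] = support4 i j l h.
Proof. by rewrite !coverage_cons coverage_nil setU0 !setUA. Qed.

(** These quadruples arise from the Taylor remainder: a centre together with three terms of its
    local sum. *)
Lemma star_linked4 i j l h : meet (c i) (c j) -> meet (c i) (c l) -> meet (c i) (c h) ->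
  linked4 i j l h.
Proof.
have mono (A B A' B' : {set 'I_N}) : meet A B -> A \subset A' -> B \subset B' -> meet A' B'.
  by move=> AB sA sB; apply: contraNneq AB => AB; rewrite -subset0 -AB setISS.
have mC (A B : {set 'I_N}) : meet A B = meet B A by rewrite /meet setIC.
move=> ij il ih; apply/and5P; split; last (apply/and3P; split).
- by apply: mono ij _ _; rewrite // -setUA subsetUl.
- by rewrite mC in ij; apply: mono ij _ _; rewrite // -setUA subsetUl.
- by rewrite mC in il; apply: mono il _ _; rewrite // -setUA subsetUl.
- by rewrite mC in ih; apply: mono ih _ _; rewrite // -setUA subsetUl.
- by apply: mono il _ _; rewrite subsetUl.
- by apply: mono ij _ _; rewrite subsetUl.
- by apply: mono ij _ _; rewrite subsetUl.
Qed.

(** These quadruples arise from the variance of [Q]: two meeting pairs that are not independent of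
    each other. *)
Lemma pairs_linked4 i j l h : meet (c i) (c j) -> meet (c l) (c h) ->
  meet (c i :|: c j) (c l :|: c h) -> linked4 i j l h.
Proof.
have mono (A B A' B' : {set 'I_N}) : meet A B -> A \subset A' -> B \subset B' -> meet A' B'.
  by move=> AB sA sB; apply: contraNneq AB => AB; rewrite -subset0 -AB setISS.
have mC (A B : {set 'I_N}) : meet A B = meet B A by rewrite /meet setIC.
move=> ij lh ijlh; apply/and5P; split; last (apply/and3P; split) => //.
- by apply: mono ij _ _; rewrite // -setUA subsetUl.
- by rewrite mC in ij; apply: mono ij _ _; rewrite // -setUA subsetUl.
- by apply: mono lh _ _; rewrite // subsetUr.
- by rewrite mC in lh; apply: mono lh _ _; rewrite // subsetUr.
- by apply: mono ij _ _; rewrite subsetUl.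
- by apply: mono ij _ _; rewrite subsetUl.
Qed.

Lemma Ex_absloc3 : S (fun i => E (fun w => `|centered i w| * absloc i w ^+ 3)) <= 16 * D.
Proof.
rewrite -wsumZ; apply: ler_wsum => // i.
have -> : E (fun w => `|centered i w| * absloc i w ^+ 3) =
    S (fun j => S (fun l => S (fun h => ((meet (c i) (c j))%:R * (meet (c i) (c l))%:R *
      (meet (c i) (c h))%:R) * E (fun w => \prod_(a <- [:: i; j; l; h]) `|centered a w|)))).
  transitivity (E (fun w => S (fun j => S (fun l => S (fun h =>
      ((meet (c i) (c j))%:R * (meet (c i) (c l))%:R * (meet (c i) (c h))%:R) *
      (\prod_(a <- [:: i; j; l; h]) `|centered a w|)))))).
    apply: eq_Ex => w.
    have -> : absloc i w ^+ 3 = S (fun j => (meet (c i) (c j))%:R * `|centered j w| *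
        S (fun l => (meet (c i) (c l))%:R * `|centered l w| * absloc i w)).
      by rewrite !wsumZr.
    rewrite -wsumZ; apply: eq_wsum => j; rewrite mulrA -wsumZ; apply: eq_wsum => l.
    rewrite mulrA -wsumZ; apply: eq_wsum => h; rewrite !big_cons big_nil; ring.
  by do 3!(rewrite Ex_wsum; apply: eq_wsum => ?); rewrite ExZ.
rewrite -wsumZ; apply: ler_wsum => // j; rewrite -wsumZ; apply: ler_wsum => // l.
rewrite -wsumZ; apply: ler_wsum => // h.
have := Ex_prod_norm_centered c p_small [:: i; j; l; h]; rewrite support4E /= => H.
have q0 := q_ge0 p_small (support4 i j l h).
have [ij|_] := boolP (meet (c i) (c j)); last by rewrite !mul0r; rewrite !mulr_ge0.
have [il|_] := boolP (meet (c i) (c l)); last by rewrite mulr0 !mul0r; rewrite !mulr_ge0.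
have [ih|_] := boolP (meet (c i) (c h)); last by rewrite mulr0 !mul0r; rewrite !mulr_ge0.
by rewrite star_linked4 // !mul1r (le_trans H) // ler_wpM2r // -natrX ler_nat.
Qed.

Lemma Ex_absloc1 : S (fun i => E (fun w => `|centered i w| * absloc i w)) <= 4 * meeting_mass.
Proof.
rewrite -wsumZ; apply: ler_wsum => // i.
have -> : E (fun w => `|centered i w| * absloc i w) = S (fun j => (meet (c i) (c j))%:R *
    E (fun w => \prod_(a <- [:: i; j]) `|centered a w|)).
  under eq_wsum => j do rewrite -ExZ.
  rewrite -Ex_wsum; apply: eq_Ex => w; rewrite -wsumZ; apply: eq_wsum => j.
  rewrite !big_cons big_nil; ring.
rewrite -wsumZ; apply: ler_wsum => // j; rewrite mulrCA ler_wpM2l //.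
have := Ex_prod_norm_centered c p_small [:: i; j].
by rewrite !coverage_cons coverage_nil setU0 /= -natrX.
Qed.

(** The random coefficient of F'(W) in the linear Taylor term. Its mean is [v], so its variance
    measures the error of replacing it by [v]. *)
Let Q w := S (fun i => centered i w * local_sum i w).

Lemma Ex_centered_local i : E (fun w => centered i w * local_sum i w) = S (moment2 i).
Proof.
transitivity (E (fun w => S (fun j => (meet (c i) (c j))%:R * (centered i w * centered j w)))).
  by apply: eq_Ex => w; rewrite -wsumZ; apply: eq_wsum => j; ring.
rewrite Ex_wsum; apply: eq_wsum => j; rewrite ExZ.
have -> : E (fun w => centered i w * centered j w) = moment2 i j.
  by apply: eq_Ex => w; rewrite allon0 !big_cons big_nil mulr1 mul1r.
have [_|] := boolP (meet _ _); first by rewrite mul1r.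
by rewrite negbK mul0r => /eqP/moment2_disj->.
Qed.

Lemma Ex_Q : E Q = v.
Proof. by rewrite /Q Ex_wsum csum_varE; apply: eq_wsum => i; rewrite Ex_centered_local. Qed.

(** The variance of [Q] is a sum over two meeting pairs. Pairs with disjoint unions contribute zero
    by [moment4_split]; all others are linked, and 16 = 2^4 comes from [moment_norm_le]. *)
Lemma Ex_Q_sqr : E (fun w => (Q w - v) ^+ 2) <= 16 * D.
Proof.
have -> : E (fun w => (Q w - v) ^+ 2) = E (fun w => Q w ^+ 2) - v ^+ 2.
  transitivity (E (fun w => Q w ^+ 2 - (2 * v) * Q w + v ^+ 2)).
    by apply: eq_Ex => w; ring.
  by rewrite ExD ExB ExZ Ex_Q Ex_cst //; ring.
have -> : E (fun w => Q w ^+ 2) = S (fun i => S (fun j => S (fun l => S (fun h =>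
    ((meet (c i) (c j))%:R * (meet (c l) (c h))%:R) * moment4 i j l h)))).
  transitivity (E (fun w => S (fun i => S (fun j => S (fun l => S (fun h =>
    ((meet (c i) (c j))%:R * (meet (c l) (c h))%:R) *
    (allon R set0 w * \prod_(a <- [:: i; j; l; h]) centered a w))))))).
    apply: eq_Ex => w; rewrite expr2 {1}/Q -wsumZr; apply: eq_wsum => i.
    rewrite mulrAC mulrC /local_sum -wsumZr; apply: eq_wsum => j.
    rewrite {1}/Q -wsumZ -wsumZ; apply: eq_wsum => l.
    rewrite /local_sum -!wsumZ; apply: eq_wsum => h.
    by rewrite allon0 !big_cons big_nil; ring.
  by do 4!(rewrite Ex_wsum; apply: eq_wsum => ?); rewrite ExZ.
have -> : v ^+ 2 = S (fun i => S (fun j => S (fun l => S (fun h =>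
    ((meet (c i) (c j))%:R * (meet (c l) (c h))%:R) * (moment2 i j * moment2 l h))))).
  rewrite expr2 csum_varE wsum2M; do 4!(apply: eq_wsum => ?).
  have m2 a b : moment2 a b = (meet (c a) (c b))%:R * moment2 a b.
    have [_|] := boolP (meet _ _); first by rewrite mul1r.
    by rewrite negbK mul0r => /eqP/moment2_disj->.
  rewrite [in LHS]m2 [X in _ * X]m2; ring.
rewrite -wsumZ -wsumB; apply: ler_wsum => // i; rewrite -wsumZ -wsumB; apply: ler_wsum => // j.
rewrite -wsumZ -wsumB; apply: ler_wsum => // l; rewrite -wsumZ -wsumB; apply: ler_wsum => // h.
have q0 := q_ge0 p_small (support4 i j l h).
rewrite -mulrBr.
have [ij|_] := boolP (meet (c i) (c j)); last by rewrite !mul0r !mulr_ge0.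
have [lh|_] := boolP (meet (c l) (c h)); last by rewrite mulr0 !mul0r !mulr_ge0.
rewrite !mul1r; have [X|] := boolP (meet (c i :|: c j) (c l :|: c h)); last first.
  by rewrite negbK => /eqP/moment4_split-> //; rewrite subrr !mulr_ge0.
rewrite pairs_linked4 // mul1r lerBlDr ler_wpDr ?mulr_ge0 ?moment2_ge0 //.
apply: le_trans (ler_norm _) _.
by apply: le_trans (moment_norm_le c p_small _) _; rewrite support4E -natrX ler_wpM2r ?ler_nat.
Qed.

(** Since E Y_i F(rest_i) = 0, each term of E W F(W) only sees the increment of F over the local
    sum. Expanding this increment at W, not at rest_i, makes the linear terms add up to Q F'(W). *)
Lemma stein_bound (F F' : R -> R) (L1 L2 a : R) : 0 < a -> 0 <= L1 -> 0 <= L2 ->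
  (forall x, `|F' x| <= L1) ->
  (forall x y, `|F y - F x - (y - x) * F' y| <= L2 * (y - x) ^+ 2) ->
  v <= 1 ->
  `|E (fun w => W w * F (W w)) - v * E (fun w => F' (W w))| <=
  (L1 + L2) * (9 * a + 16 * D / a).
Proof.
move=> a0 L10 L20 hF' hF v1.
pose rest i w := W w - local_sum i w.
have dep i : depends_off (c i) (fun w => F (rest i w)).
  move=> w w' ww'; congr F; rewrite /rest /W /local_sum -!wsumB; apply: eq_wsum => j.
  have [_|] := boolP (meet _ _); first by rewrite !mul1r !subrr.
  rewrite negbK setI_eq0 !mul0r !subr0 => d.
  exact: (depends_off_centered p d ww').
pose err i w := F (W w) - F (rest i w) - local_sum i w * F' (W w).
have -> : E (fun w => W w * F (W w)) - v * E (fun w => F' (W w)) =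
    S (fun i => E (fun w => centered i w * err i w)) + E (fun w => (Q w - v) * F' (W w)).
  have -> : E (fun w => W w * F (W w)) = S (fun i => E (fun w => centered i w * err i w)) +
      E (fun w => Q w * F' (W w)).
    rewrite -Ex_wsum -ExD; transitivity (E (fun w => S (fun i => centered i w * err i w) +
      Q w * F' (W w) + S (fun i => centered i w * F (rest i w)))).
      apply: eq_Ex => w; rewrite /Q /W -!wsumZr -!wsumD; apply: eq_wsum => i.
      by rewrite /err /W; ring.
    rewrite ExD [X in _ + X]Ex_wsum [X in _ + X](_ : _ = S (fun=> 0)); last first.
      by apply: eq_wsum => i; apply: Ex_centered.
    by rewrite [X in _ + X]big1 ?addr0 // => i _; rewrite mulr0.
  rewrite -addrA; congr (_ + _); rewrite -ExZ -ExB; apply: eq_Ex => w; ring.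
(* Only the second moment of Q - v and the cube of the local sum are bounded by [D]; these two
   inequalities interpolate with the free parameter [a]. *)
have amgm2 x : `|x| <= a + x ^+ 2 / a.
  rewrite -(ler_pM2l a0) mulrDr (_ : a * (x ^+ 2 / a) = x ^+ 2); last by field; rewrite gt_eqF.
  by rewrite -[x ^+ 2]real_normK ?num_real //; have := normr_ge0 x; nra.
have amgm3 t : 0 <= t -> t ^+ 2 <= a * t + t ^+ 3 / a.
  move=> t0; rewrite -(ler_pM2l a0) mulrDr.
  rewrite (_ : a * (t ^+ 3 / a) = t ^+ 3); last by field; rewrite gt_eqF.
  have := mulr_ge0 t0 (sqr_ge0 (2 * a - t)); have := mulr_ge0 t0 (sqr_ge0 t).
  by rewrite !expr2 !exprS expr0; lra.
have D0 := linked_mass_ge0.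
have X1 : E (fun w => `|Q w - v|) <= a + 16 * D / a.
  apply: le_trans (_ : E (fun w => a + (Q w - v) ^+ 2 / a) <= _).
    by apply: (ler_Ex p01) => w; apply: amgm2.
  by rewrite ExD Ex_cst ExZr lerD2l ler_pM2r ?invr_gt0 ?Ex_Q_sqr.
have X2 : S (fun i => E (fun w => `|centered i w| * absloc i w ^+ 2)) <= 9 * a + 16 * D / a.
  apply: le_trans (_ : a * S (fun i => E (fun w => `|centered i w| * absloc i w)) +
      S (fun i => E (fun w => `|centered i w| * absloc i w ^+ 3)) / a <= _).
    rewrite -wsumZ -wsumZr -wsumD; apply: ler_wsum => // i.
    rewrite -ExZ -ExZr -ExD; apply: (ler_Ex p01) => w.
    by rewrite [leRHS](_ : _ = `|centered i w| * (a * absloc i w + absloc i w ^+ 3 / a));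
      [rewrite ler_wpM2l ?amgm3 | ring].
  apply: lerD; last by rewrite ler_pM2r ?invr_gt0 ?Ex_absloc3.
  (* The first-order part is at most 4 / (1 - p), by [v <= 1]; for p at most 1/20 this is below
     9. *)
  rewrite mulrC ler_pM2r //; apply: le_trans Ex_absloc1 _.
  have := meeting_mass_le; have : 0 <= meeting_mass.
    by do 2!(apply: wsum_ge0 => // ?); rewrite mulr_ge0 ?q_ge0.
  by case/andP: p_small => ? ?; nra.
rewrite mulrDl addrC; apply: le_trans (ler_normD _ _) _; apply: lerD.
  apply: le_trans (_ : L1 * E (fun w => `|Q w - v|) <= _).
    rewrite -ExZ; apply: le_trans (normr_Ex p01 _) _; apply: (ler_Ex p01) => w.
    by rewrite normrM mulrC ler_wpM2r.
  by rewrite ler_wpM2l // (le_trans X1) // lerD2r; lra.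
apply: le_trans (ler_wpM2l L20 X2); rewrite -wsumZ.
apply: le_trans (normr_wsum m_ge0 _) _; apply: ler_wsum => // i.
rewrite -ExZ; apply: le_trans (normr_Ex p01 _) _; apply: (ler_Ex p01) => w.
rewrite normrM mulrCA ler_wpM2l //; have := hF (rest i w) (W w).
rewrite /rest subKr; move=> /le_trans; apply; rewrite ler_wpM2l //.
rewrite -[local_sum _ _ ^+ 2]real_normK ?num_real //.
by rewrite ler_pXn2r ?nnegrE ?normr_local_sum.
Qed.

End SteinBound.

(** * Moment bounds for weights without heavy sets *)

Section MomentBounds.
Variables (R : realType) (N : nat) (p : R) (I : finType) (c : I -> {set 'I_N}).
Variables (m : I -> R) (k s0 : nat) (t S0 : R).
Hypothesis p_small : 0 < p <= 1 / 20.
Hypothesis m_ge0 : forall i, 0 <= m i.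
Local Notation E := (@Ex R N p).
Local Notation q := (@q R N p).
Local Notation S := (wsum m).
Local Notation centered := (centered p c).
Hypothesis card_c : forall i, (#|c i| <= k)%N.
Hypothesis light : forall A : {set 'I_N}, A != set0 ->
  S (fun i => (A \subset c i)%:R * q (c i)) <= t * q A.
Hypothesis t_ge0 : 0 <= t.
Hypothesis S0_ge1 : 1 <= S0.
Hypothesis S0_t : 2 ^+ s0 * t <= S0.
Hypothesis S0_mass : meeting_mass p c m <= S0.
Implicit Types (A B : {set 'I_N}) (i j : I) (P : pred I) (Ps d : seq (pred I)).

Let p01 : 0 <= p <= 1. Proof. by case/andP: p_small => ??; apply/andP; split; lra. Qed.
Let q_ge0 A : 0 <= q A. Proof. exact: q_ge0. Qed.

(** If A = B meets c i exactly in the trace [B :&: c i], then [q (B :|: c i)] is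
    [q B * q (c i) / q A] for that trace A. Summing [light] over all nonempty subsets A of B costs
    the factor [2 ^+ s0]. *)
Lemma touching_mass B : (#|B| <= s0)%N ->
  S (fun i => (meet B (c i))%:R * q (B :|: c i)) <= S0 * q B.
Proof.
move=> Bs; apply: le_trans (_ : 2 ^+ s0 * t * q B <= _); last by rewrite ler_wpM2r.
apply: le_trans (_ : \sum_(A in powerset B | A != set0) q B / q A *
  S (fun i => (A \subset c i)%:R * q (c i)) <= _); last first.
  apply: le_trans (_ : \sum_(A in powerset B) t * q B <= _).
    rewrite big_mkcondr; apply: ler_sum => A _; case: ifPn => [A0|_]; last first.
      by rewrite mulr_ge0.
    apply: le_trans (ler_wpM2l _ (light A0)) _; first by rewrite divr_ge0.
    have qA : q A != 0 by rewrite gt_eqF ?q_gt0.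
    by rewrite (mulrC t) mulrA divfK // mulrC lexx.
  rewrite sumr_const card_powerset -[leLHS]mulr_natl natrX mulrA ler_wpM2r // ler_wpM2r //.
  by rewrite ler_weXn2l // ler1n.
rewrite (eq_bigr _ (fun A _ => esym (wsumZ _ _ _))).
have -> F : \sum_(A in powerset B | A != set0) S (F A) =
    S (fun i => \sum_(A in powerset B | A != set0) F A i).
  by rewrite exchange_big; apply: eq_bigr => i _; rewrite mulr_sumr.
apply: ler_wsum => // i; have [Bi|_] := boolP (meet B (c i)); last first.
  by rewrite mul0r sumr_ge0 // => A _; rewrite !mulr_ge0 // invr_ge0.
rewrite (bigD1 (B :&: c i)) /=; last by rewrite powersetE subsetIl.
rewrite subsetIr !mul1r mulrAC qUI // mulfK ?lerDl; last by rewrite gt_eqF ?q_gt0.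
by rewrite sumr_ge0 // => A _; rewrite !mulr_ge0 // invr_ge0.
Qed.

(* Moments are taken of products of partial sums, so that each factor can be split into the
   part touching a given set, which is estimated by [light], and an independent part. *)
Definition psum P (w : outcome N) : R := S (fun i => (P i)%:R * centered i w).

Definition pmoment B Ps := E (fun w => allon R B w * \prod_(P <- Ps) psum P w).

Local Notation pm := pmoment.

Lemma pmoment_perm B Ps Qs : (forall f : pred I -> R,
  \prod_(P <- Ps) f P = \prod_(P <- Qs) f P) -> pm B Ps = pm B Qs.
Proof. by move=> PQ; apply: eq_Ex => w; rewrite PQ. Qed.

Lemma pmoment_cons B P Ps : pm B (P :: Ps) =
  S (fun i => (P i)%:R * (pm (B :|: c i) Ps - q (c i) * pm B Ps)).
Proof.
transitivity (E (fun w => S (fun i => (P i)%:R * ((allon R (B :|: c i) w - q (c i) *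
    allon R B w) * \prod_(Q <- Ps) psum Q w)))).
  apply: eq_Ex => w; rewrite big_cons mulrA (mulrC (allon _ _ _)) -mulrA /psum -wsumZr.
  by apply: eq_wsum => i; rewrite allonU /centered; ring.
rewrite Ex_wsum; apply: eq_wsum => i; rewrite ExZ; congr (_ * _).
rewrite /pmoment -ExZ -ExB; by apply: eq_Ex => w; ring.
Qed.

Definition pand P (Q : pred I) : pred I := fun i => P i && Q i.

Definition avoids B P := forall j, P j -> ~~ meet B (c j).

Fixpoint all_avoid B Ps := if Ps is P :: Ps' then avoids B P /\ all_avoid B Ps' else True.

Lemma pmoment_avoid B Ps : all_avoid B Ps -> pm B Ps = q B * pm set0 Ps.
Proof.
move=> av; have -> : pm set0 Ps = E (fun w => \prod_(P <- Ps) psum P w).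
  by apply: eq_Ex => w; rewrite allon0 mul1r.
apply: Ex_allon_indep => // w w' ww'; elim: Ps av => [|P Ps IHs]; rewrite ?big_nil //=.
case=> avP /IHs e; rewrite !big_cons e; congr (_ * _); apply: eq_wsum => j.
have [/avP|_] := boolP (P j); rewrite ?mul0r // negbK setI_eq0 => dj.
by rewrite (depends_off_centered p dj ww').
Qed.

Lemma pmoment_split B P (Q : pred I) Ps : pm B (P :: Ps) =
  pm B (pand P Q :: Ps) + pm B (pand P (fun i => ~~ Q i) :: Ps).
Proof.
rewrite !pmoment_cons -wsumD; apply: eq_wsum => i; rewrite /pand.
by case: (P i); case: (Q i); rewrite /= ?mul0r ?mul1r ?addr0 ?add0r.
Qed.

(** The 6 is 2 + 4: each of the r + 1 factors costs [2 * S0] for its part touching the current set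
    ([pmoment_touching]), and the avoiding rest costs at most [4 * S0] per factor
    ([pmoment_set0]). *)
Fixpoint moment_cst r : R := if r is r'.+1 then r'.+1%:R * (6 * S0) * moment_cst r' else 1.
Local Notation K := moment_cst.

Lemma moment_cst_ge0 r : 0 <= K r.
Proof.
by elim: r => //= r IHr; rewrite !mulr_ge0 //; apply: le_trans S0_ge1.
Qed.

Lemma moment_cst_le r : K r <= K r.+1.
Proof.
rewrite /= ler_peMl ?moment_cst_ge0 //.
have : 1 <= r.+1%:R :> R by rewrite ler1n.
by have := S0_ge1; nra.
Qed.

Section Step.
Variable r : nat.
Hypothesis IHr : forall B Ps, size Ps = r -> (#|B| + k * r <= s0)%N ->
  `|pm B Ps| <= K r * q B.

(** Expanding one factor gives two terms, hence the 2. It enlarges the set by at most k vertices and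
    uses up one factor, so the budget [s0] for the set size plus k per remaining factor is
    respected. *)
Lemma pmoment_touching B P Ps : size Ps = r -> (#|B| + k * r.+1 <= s0)%N ->
  `|pm B (pand P (fun i => meet B (c i)) :: Ps)| <= 2 * S0 * K r * q B.
Proof.
move=> sz sB; rewrite pmoment_cons; apply: le_trans (normr_wsum m_ge0 _) _.
apply: le_trans (_ : 2 * K r * S (fun i => (meet B (c i))%:R * q (B :|: c i)) <= _).
  rewrite -wsumZ; apply: ler_wsum => // i; rewrite normrM normr_nat /pand.
  have [Bi|_] := boolP (meet B (c i)); last by rewrite andbF !mul0r mulr0.
  rewrite andbT mul1r; apply: le_trans (_ : 1 * `|pm (B :|: c i) Ps - q (c i) * pm B Ps| <= _).
    by rewrite ler_wpM2r // lern1 leq_b1.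
  have cB : (#|B :|: c i| + k * r <= s0)%N.
    apply: leq_trans sB; rewrite mulnS addnA leq_add2r (leq_trans (leq_card_setU _ _)) //.
    by rewrite leq_add2l.
  have cB' : (#|B| + k * r <= s0)%N.
    by apply: leq_trans sB; rewrite leq_add2l leq_mul2l leqnSn orbT.
  rewrite mul1r; apply: le_trans (ler_normB _ _) _; rewrite normrM (ger0_norm (q_ge0 _)).
  have := IHr sz cB; have := ler_wpM2l (q_ge0 (c i)) (IHr sz cB').
  have := ler_wpM2l (moment_cst_ge0 r) (qM_le p_small B (c i)); lra.
have sB' : (#|B| <= s0)%N by apply: leq_trans sB; rewrite leq_addr.
have := ler_wpM2l (moment_cst_ge0 r) (touching_mass sB'); lra.
Qed.

(** The factors are treated in turn: the part touching B is estimated at once, and the avoiding part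
    is moved to [d]. In the end all factors avoid B, which is the case covered by [b]. *)
Lemma pmoment_peel B Ps d b : all_avoid B d -> (size Ps + size d = r.+1)%N ->
  (#|B| + k * r.+1 <= s0)%N ->
  (forall d', all_avoid B d' -> size d' = r.+1 -> `|pm B d'| <= b) ->
  `|pm B (Ps ++ d)| <= (size Ps)%:R * (2 * S0 * K r * q B) + b.
Proof.
move=> avd sz sB hb; elim: Ps d avd sz => [|P Ps IHs] d avd /= sz.
  by rewrite mul0r add0r; apply: hb.
rewrite (pmoment_split _ _ (fun i => meet B (c i))); apply: le_trans (ler_normD _ _) _.
rewrite -natr1 mulrDl mul1r addrAC [leRHS]addrC lerD //.
  by apply: pmoment_touching => //; rewrite size_cat; case: sz.
set Q := pand P (fun _ => ~~ _); rewrite (@pmoment_perm _ _ (Ps ++ Q :: d)); last first.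
  by move=> f; rewrite big_cons !big_cat big_cons /=; ring.
apply: IHs; last by rewrite /= addnS.
by split=> // j /andP[].
Qed.

End Step.

Section Step2.
Variable r : nat.
Hypothesis IHr : forall B Ps, size Ps = r -> (#|B| + k * r <= s0)%N ->
  `|pm B Ps| <= K r * q B.
Hypothesis kr : (k * r.+2 <= s0)%N.

(** This is the expectation of Y_i times the product of the partial sums, with Y_i multiplied
    out. *)
Local Notation pc i Ps := (pm (c i) Ps - q (c i) * pm set0 Ps).

(** Multiplying out Y_i Y_j gives four terms, each at most K_r times [q (c i :|: c j)]. *)
Lemma pmoment_centered_touching i P Ps : size Ps = r ->
  `|pc i (pand P (fun j => meet (c i) (c j)) :: Ps)| <=
  4 * K r * S (fun j => (meet (c i) (c j))%:R * q (c i :|: c j)).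
Proof.
move=> sz; rewrite /pand !pmoment_cons -wsumZ -wsumB -wsumZ; apply: le_trans (normr_wsum m_ge0 _) _.
apply: ler_wsum => // j /=.
have [ij|_] := boolP (meet (c i) (c j)); last by rewrite andbF !mul0r !mulr0 subr0 normr0.
rewrite andbT mul1r set0U.
rewrite (_ : _ - _ = (P j)%:R * (pm (c i :|: c j) Ps - q (c j) * pm (c i) Ps -
  (q (c i) * pm (c j) Ps - (q (c i) * q (c j)) * pm set0 Ps))); last by ring.
rewrite normrM normr_nat.
apply: le_trans (_ : 1 * `|pm (c i :|: c j) Ps - q (c j) * pm (c i) Ps -
  (q (c i) * pm (c j) Ps - (q (c i) * q (c j)) * pm set0 Ps)| <= _).
  by rewrite ler_wpM2r // lern1 leq_b1.
have bd B : (#|B| <= k + k)%N -> `|pm B Ps| <= K r * q B.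
  move=> B2; apply: IHr => //; apply: leq_trans kr.
  by rewrite !mulnS addnA leq_add2r.
have b1 := bd (c i :|: c j) (leq_trans (leq_card_setU _ _) (leq_add (card_c i) (card_c j))).
have b2 := bd (c i) (leq_trans (card_c i) (leq_addr _ _)).
have b3 := bd (c j) (leq_trans (card_c j) (leq_addr _ _)).
have b4 : `|pm set0 Ps| <= K r * q set0 by apply: bd; rewrite cards0.
rewrite q_set0 // mulr1 in b4.
rewrite mul1r; apply: le_trans (ler_normB _ _) _.
apply: le_trans (lerD (ler_normB _ _) (ler_normB _ _)) _.
rewrite !normrM !(ger0_norm (q_ge0 _)).
have := ler_wpM2l (moment_cst_ge0 r) (qM_le p_small (c i) (c j)).
have := ler_wpM2l (q_ge0 (c j)) b2; have := ler_wpM2l (q_ge0 (c i)) b3.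
have := ler_wpM2l (mulr_ge0 (q_ge0 (c i)) (q_ge0 (c j))) b4.
lra.
Qed.

(** The peeling of [pmoment_peel] with [c i] in place of B; here the fully avoiding rest vanishes,
    as Y_i is centred and independent of it. *)
Lemma pmoment_centered i Ps d : all_avoid (c i) d -> (size Ps + size d = r.+1)%N ->
  `|pc i (Ps ++ d)| <= (size Ps)%:R *
  (4 * K r * S (fun j => (meet (c i) (c j))%:R * q (c i :|: c j))).
Proof.
elim: Ps d => [|P Ps IHs] d avd /= sz.
  by rewrite mul0r pmoment_avoid // subrr normr0.
rewrite !(pmoment_split _ P (fun j => meet (c i) (c j))) mulrDr opprD addrACA.
apply: le_trans (ler_normD _ _) _; rewrite -natr1 mulrDl mul1r [leRHS]addrC lerD //.
  by apply: pmoment_centered_touching; rewrite size_cat; case: sz.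
set Q := pand P (fun _ => ~~ _); rewrite !(@pmoment_perm _ (Q :: _) (Ps ++ Q :: d)); last first.
- by move=> f; rewrite big_cons !big_cat big_cons /=; ring.
- by move=> f; rewrite big_cons !big_cat big_cons /=; ring.
apply: IHs; last by rewrite /= addnS.
by split=> // j /andP[].
Qed.

(** Nothing touches the empty set, so the first factor is expanded and its set c i takes over that
    role. Some other factor must meet c i, and the sum over both indices is the meeting mass. Two
    factors are used, which leaves K_r. *)
Lemma pmoment_set0 Ps : size Ps = r.+2 -> `|pm set0 Ps| <= r.+1%:R * (4 * S0 * K r).
Proof.
case: Ps => // P Ps [sz]; rewrite pmoment_cons; apply: le_trans (normr_wsum m_ge0 _) _.
apply: le_trans (_ : r.+1%:R * (4 * K r * meeting_mass p c m) <= _); last first.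
  rewrite ler_wpM2l // -mulrA -mulrA ler_wpM2l // mulrC ler_wpM2r // moment_cst_ge0 //.
rewrite -!wsumZ; apply: ler_wsum => // i; rewrite normrM normr_nat set0U.
apply: le_trans (_ : 1 * `|pc i Ps| <= _); first by rewrite ler_wpM2r // lern1 leq_b1.
rewrite mul1r; have := @pmoment_centered i Ps [::] Logic.I; rewrite cats0 sz addn0.
exact.
Qed.

End Step2.

Lemma pmoment_le r B Ps : size Ps = r -> (#|B| + k * r <= s0)%N ->
  `|pm B Ps| <= K r * q B.
Proof.
elim/ltn_ind: r B Ps => -[|r] IH B Ps sz sB.
  case: Ps sz => // _; rewrite /pm /= mul1r; under eq_Ex => w do rewrite big_nil mulr1.
  by rewrite Ex_allon ger0_norm ?lexx //; apply: q_ge0.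
have K0 := moment_cst_ge0 r.
have := @pmoment_peel r (IH r (ltnSn r)) B Ps [::] (r%:R * (4 * S0 * K r) * q B) Logic.I.
rewrite cats0 addn0 => /(_ sz sB) H; apply: le_trans (H _) _.
  move=> d av sd; rewrite pmoment_avoid // normrM ger0_norm // mulrC ler_wpM2r //.
  (* A single avoiding factor has mean zero; two or more reduce to [pmoment_set0], whose induction
     hypothesis lies two orders lower. This is why the induction is strong. *)
  case: r IH sz sB K0 H sd => [|r] IH sz sB K0 H sd.
    case: d av sd => // P [] //= _ _; rewrite pmoment_cons mul0r.
    rewrite [X in `|X|]big1 ?normr0 // => i _; rewrite set0U (@pmoment_avoid (c i)) //.
    by rewrite subrr !mulr0.
  apply: le_trans (@pmoment_set0 r (IH r _) _ d sd) _.
  - exact: leqW.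
  - by apply: leq_trans sB; rewrite leq_addl.
  - rewrite ler_wpM2l // ler_wpM2l ?moment_cst_le // mulr_ge0 //.
    exact: le_trans S0_ge1.
rewrite sz /= -!mulrA [in leRHS]mulrCA.
have -> : r.+1%:R = r%:R + 1 :> R by rewrite natr1.
have r0 : 0 <= r%:R :> R by [].
have X : 0 <= S0 * (K r * q B) by rewrite !mulr_ge0 //; apply: le_trans S0_ge1.
have := mulr_ge0 r0 X; lra.
Qed.

Lemma Ex_csum_le r : (k * r <= s0)%N -> `|E (fun w => csum p c m w ^+ r)| <= K r.
Proof.
move=> kr; have := @pmoment_le r set0 (nseq r xpredT) (size_nseq _ _).
rewrite cards0 q_set0 // mulr1 => /(_ kr); congr (`|_| <= _).
apply: eq_Ex => w; rewrite allon0 mul1r big_nseq iter_mulr_1; congr (_ ^+ _).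
by apply: eq_wsum => i; rewrite mul1r.
Qed.

End MomentBounds.

(** * Truncation at heavy vertex sets *)

Section Truncation.
Variables (R : realType) (N : nat) (p : R) (I : finType) (c : I -> {set 'I_N}).
Variables (m : I -> R) (k : nat) (M : R).
Hypothesis p_small : 0 < p <= 1 / 20.
Hypothesis m_ge0 : forall i, 0 <= m i.
Hypothesis card_c : forall i, (#|c i| <= k)%N.
Hypothesis M_gt0 : 0 < M.
Local Notation E := (@Ex R N p).
Local Notation q := (@q R N p).
Local Notation S := (wsum m).
Local Notation centered := (centered p c).
Hypothesis var1 : csum_var p c m = 1.
Implicit Types (A B : {set 'I_N}) (i j : I).

Let p01 : 0 <= p <= 1. Proof. by case/andP: p_small => ??; apply/andP; split; lra. Qed.
Let q_ge0 A : 0 <= q A. Proof. exact: q_ge0. Qed.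
Let q_gt0 A : 0 < q A. Proof. exact: q_gt0. Qed.

(* [q A] times the paper's local count [t_H(A)], rescaled by [p ^ (k - |A|) / sigma]. *)
Definition local_mass A : R := S (fun i => (A \subset c i)%:R * q (c i)).

Definition heavy A : bool := (A != set0) && (M * q A ^+ 2 < local_mass A ^+ 2).

Definition light_index i : bool := [forall A : {set 'I_N}, (A \subset c i) ==> ~~ heavy A].

(** Truncation sets weights to zero, so every result for nonnegative weights applies to Z_M as it
    does to Z. *)
Definition light_weight i : R := m i * (light_index i)%:R.

Local Notation mu := local_mass.

Lemma light_weight_ge0 i : 0 <= light_weight i.
Proof. by rewrite mulr_ge0. Qed.

Lemma local_mass_ge0 A : 0 <= mu A.
Proof. by apply: wsum_ge0 => // i; rewrite mulr_ge0. Qed.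

Lemma wsum_light f : wsum light_weight f = S (fun i => (light_index i)%:R * f i).
Proof. by apply: eq_bigr => i _; rewrite mulrA. Qed.

Lemma meeting_mass_le2 : meeting_mass p c m <= 2.
Proof.
have := meeting_mass_le c p_small m_ge0; rewrite var1.
have : 0 <= meeting_mass p c m.
  by do 2!(apply: wsum_ge0 => // ?); rewrite mulr_ge0.
by case/andP: p_small => ? ?; nra.
Qed.

Lemma meeting_mass_light : meeting_mass p c light_weight <= 2.
Proof.
apply: le_trans meeting_mass_le2.
rewrite /meeting_mass wsum_light; apply: ler_wsum => // i; rewrite wsum_light -wsumZ.
apply: ler_wsum => // j.
have X : 0 <= (meet (c i) (c j))%:R * q (c i :|: c j) by rewrite mulr_ge0.
by case: (light_index i); case: (light_index j); rewrite ?mul1r ?mul0r.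
Qed.

(** All covariances are nonnegative, so discarding indices can only lower the variance. *)
Lemma variance_light_le1 : csum_var p c light_weight <= 1.
Proof.
rewrite -var1 !csum_varE wsum_light; apply: ler_wsum => // i; rewrite wsum_light -wsumZ.
apply: ler_wsum => // j; have X := moment2_ge0 c p_small i j.
by case: (light_index i); case: (light_index j); rewrite ?mul1r ?mul0r.
Qed.

(** If some light index contains A, then A is not heavy and already its full local mass obeys the
    bound; otherwise the sum on the left is zero. *)
Lemma light_weight_light A : A != set0 ->
  wsum light_weight (fun i => (A \subset c i)%:R * q (c i)) <= Num.sqrt M * q A.
Proof.
move=> A0; rewrite wsum_light; have [/existsP[i /andP[Ai li]]|] :=
    boolP [exists i, (A \subset c i) && light_index i].
  apply: le_trans (_ : mu A <= _).
    apply: ler_wsum => // j; have X : 0 <= (A \subset c j)%:R * q (c j) by rewrite mulr_ge0.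
    by case: (light_index j); rewrite ?mul1r ?mul0r.
  move/forallP/(_ A): li; rewrite Ai /heavy A0 /= -leNgt => H.
  rewrite -(@ler_pXn2r _ 2) ?nnegrE ?mulr_ge0 ?local_mass_ge0 ?sqrtr_ge0 //.
  by rewrite exprMn sqr_sqrtr // ltW.
move/existsPn => none; rewrite [leLHS]big1 ?mulr_ge0 ?sqrtr_ge0 // => i _.
by have := none i; case: (A \subset c i); case: (light_index i); rewrite ?mul0r ?mulr0.
Qed.

(** Expanding the square gives pairs i, j and nonempty subsets A of [c i :&: c j]. For these, [q A]
    is at least [q] of the intersection, so each term is at most [q (c i :|: c j)], and there are at
    most 2^k of them. *)
Lemma sum_local_mass : \sum_(A | A != set0) mu A ^+ 2 / q A <= 2 ^+ k * 2.
Proof.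
apply: le_trans (_ : 2 ^+ k * meeting_mass p c m <= _); last first.
  by rewrite ler_wpM2l ?exprn_ge0 // meeting_mass_le2.
have -> : \sum_(A | A != set0) mu A ^+ 2 / q A = S (fun i => S (fun j =>
    \sum_(A | A != set0) ((A \subset c i)%:R * (A \subset c j)%:R * (q (c i) * q (c j)) / q A))).
  transitivity (\sum_(A | A != set0) S (fun i => S (fun j =>
    (A \subset c i)%:R * (A \subset c j)%:R * (q (c i) * q (c j)) / q A))).
    apply: eq_bigr => A _; rewrite expr2 wsumM -wsumZr; apply: eq_wsum => i.
    by rewrite -wsumZr; apply: eq_wsum => j; ring.
  rewrite exchange_big; apply: eq_bigr => i _; rewrite -mulr_sumr; congr (_ * _).
  by rewrite exchange_big; apply: eq_bigr => j _; rewrite -mulr_sumr.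
rewrite -wsumZ; apply: ler_wsum => // i; rewrite -wsumZ; apply: ler_wsum => // j.
have [ij|] := boolP (meet (c i) (c j)); last first.
  rewrite negbK => /eqP d; rewrite mul0r mulr0 big1 // => A A0.
  have [Ai|_] := boolP (A \subset c i); last by rewrite !mul0r.
  have [Aj|_] := boolP (A \subset c j); last by rewrite mulr0 !mul0r.
  by case/negP: A0; rewrite -subset0 -d subsetI Ai Aj.
apply: le_trans (_ : \sum_(A in powerset (c i)) q (c i :|: c j) <= _); last first.
  rewrite sumr_const card_powerset -[leLHS]mulr_natl natrX mul1r ler_wpM2r //.
  by rewrite ler_weXn2l // ler1n.
rewrite big_mkcond [leRHS]big_mkcond; apply: ler_sum => A _; rewrite powersetE.
case: ifP => A0; last by case: ifP.
have [Ai|_] := boolP (A \subset c i); last by rewrite !mul0r.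
have [Aj|_] := boolP (A \subset c j); last by rewrite mulr0 !mul0r.
rewrite !mul1r ler_pdivrMr // qUI // ler_wpM2l // q_subset //.
by rewrite subsetI Ai Aj.
Qed.

(** The mean of the discarded part before centring: where all discarded indicators vanish, Z_M
    exceeds Z by exactly this. *)
Definition centering_shift : R := S (fun i => (~~ light_index i)%:R * q (c i)).

Lemma centering_shift_ge0 : 0 <= centering_shift.
Proof. by apply: wsum_ge0 => // i; rewrite mulr_ge0. Qed.

Let not_light_le i (x : R) (f : {set 'I_N} -> R) : (forall A, 0 <= f A) ->
  (forall A, heavy A -> A \subset c i -> x <= f A) ->
  (~~ light_index i)%:R * x <= \sum_(A | heavy A) (A \subset c i)%:R * f A.
Proof.
move=> f0 fx; have [_|] := boolP (light_index i).
  by rewrite mul0r sumr_ge0 // => A _; rewrite mulr_ge0.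
case/forallPn => A; rewrite negb_imply negbK => /andP[Ai hA].
rewrite mul1r (bigD1 A) //= Ai mul1r ler_wpDr ?fx //.
by rewrite sumr_ge0 // => B _; rewrite mulr_ge0.
Qed.

(** A union bound over the heavy subset of each discarded set gives the sum of [mu A] over heavy A.
    There [mu A] exceeds [Num.sqrt M * q A], so the sum is compared with [sum_local_mass]. *)
Lemma centering_shift_le : centering_shift <= 2 ^+ k * 2 / Num.sqrt M.
Proof.
have sM : 0 < Num.sqrt M by rewrite sqrtr_gt0.
apply: le_trans (_ : \sum_(A | heavy A) mu A <= _).
  rewrite exchange_big; apply: ler_sum => i _; rewrite -mulr_sumr ler_wpM2l //.
  exact: (@not_light_le i _ (fun=> q (c i))).
rewrite ler_pdivlMr // mulr_suml; apply: le_trans sum_local_mass.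
rewrite [leRHS](bigID (fun A => M * q A ^+ 2 < mu A ^+ 2)) /=.
rewrite ler_wpDr ?sumr_ge0 // => [A _|]; first by rewrite divr_ge0 ?sqr_ge0.
apply: ler_sum => A /andP[_ hA].
have lt : Num.sqrt M * q A < mu A.
  rewrite -(@ltr_pXn2r _ 2) ?nnegrE ?mulr_ge0 ?local_mass_ge0 ?sqrtr_ge0 //.
  by rewrite exprMn sqr_sqrtr // ltW.
by rewrite ler_pdivlMr // expr2 -mulrA ler_wpM2l ?local_mass_ge0 ?ltW.
Qed.

Definition light_event (w : outcome N) : bool :=
  [forall A : {set 'I_N}, heavy A ==> ~~ (A \subset [set v | w v])].

(** A union bound over heavy sets, where [q A] is less than [mu A ^+ 2 / q A] divided by M. *)
Lemma Prob_light_event : Prob p (fun w => ~~ light_event w) <= 2 ^+ k * 2 / M.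
Proof.
rewrite ProbE; apply: le_trans (_ : \sum_(A | heavy A) q A <= _).
  under eq_bigr => A _ do rewrite /q -Ex_allon.
  rewrite -Ex_sum; apply: (ler_Ex p01) => w; have [_|] := boolP (light_event w).
    by rewrite sumr_ge0 // => A _; apply: allon_ge0.
  case/forallPn => A; rewrite negb_imply negbK => /andP[hA Aw].
  rewrite (bigD1 A) //= /allon Aw ler_wpDr // sumr_ge0 // => B _; exact: allon_ge0.
rewrite ler_pdivlMr // mulr_suml; apply: le_trans sum_local_mass.
rewrite [leRHS](bigID (fun A => M * q A ^+ 2 < mu A ^+ 2)) /=.
rewrite ler_wpDr ?sumr_ge0 // => [A _|]; first by rewrite divr_ge0 ?sqr_ge0.
apply: ler_sum => A /andP[_ hA].
by rewrite ler_pdivlMr // mulrAC -expr2 mulrC ltW.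
Qed.

(** The discarded indicators are nonnegative, so dropping them can raise the sum only through their
    centring. This one-sided bound holds at every outcome. *)
Lemma csum_light_le w : csum p c light_weight w <= csum p c m w + centering_shift.
Proof.
rewrite /csum wsum_light -wsumD; apply: ler_wsum => // i; rewrite /centered.
have [_|_] := boolP (light_index i); first by rewrite mul1r mul0r addr0.
by rewrite mul0r mul1r subrK; apply: allon_ge0.
Qed.

Lemma csum_light w : light_event w -> csum p c light_weight w = csum p c m w + centering_shift.
Proof.
move=> lw; rewrite /csum wsum_light -wsumD; apply: eq_wsum => i; rewrite /centered.
have [_|] := boolP (light_index i); first by rewrite mul1r mul0r addr0.
rewrite mul0r mul1r subrK; case/forallPn => A; rewrite negb_imply negbK => /andP[Ai hA].
move/forallP/(_ A): lw; rewrite hA /= /allon; case: (boolP (c i \subset _)) => // ci.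
by rewrite (subset_trans Ai ci).
Qed.

(** The budget is [k * r], local masses are bounded with [Num.sqrt M], and the summand 2 covers the
    meeting mass. The bound depends on M and r but not on the graph. *)
Lemma Ex_csum_light_le r :
  `|E (fun w => csum p c light_weight w ^+ r)| <=
  moment_cst (2 ^+ (k * r) * Num.sqrt M + 2) r.
Proof.
apply: (@Ex_csum_le _ _ p _ c light_weight k (k * r) (Num.sqrt M)) => //.
- exact: light_weight_ge0.
- exact: light_weight_light.
- by rewrite sqrtr_ge0.
- by rewrite ler_wpDl ?mulr_ge0 ?exprn_ge0 ?sqrtr_ge0 // ler1n.
- by rewrite lerDl.
- by apply: le_trans meeting_mass_light _; rewrite lerDr mulr_ge0 ?exprn_ge0 ?sqrtr_ge0.
Qed.

End Truncation.

(** * Subgraph counts as weighted sums *)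

Section SubgraphCounts.
Variables (R : realType) (N : nat) (adj : rel 'I_N) (k : nat) (eH : rel 'I_k) (p : R).
Hypothesis p_small : 0 < p <= 1 / 20.
Hypothesis var_gt0 : 0 < VarT adj eH p.
Local Notation I := {ffun 'I_k -> 'I_N}.
Local Notation E := (@Ex R N p).
Local Notation q := (@q R N p).
Local Notation sigma := (sigmaT adj eH p).
Implicit Types (s : I) (w : outcome N) (A : {set 'I_N}).

Let p_gt0 : 0 < p. Proof. by case/andP: p_small. Qed.

Definition image_set s : {set 'I_N} := [set x in codom s].

(** The index type consists of all maps, with weight zero on those that are not injective. Labelled
    tuples replace copies, so each copy is spread over its labellings and 1 / |Aut(H)| enters the
    weight. *)
Definition copy_weight s : R :=
  if injectiveb s then (num_aut eH)%:R^-1 * MH R adj eH s / sigma else 0.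

Local Notation c := image_set.
Local Notation m := copy_weight.

Lemma sigma_gt0 : 0 < sigma. Proof. by rewrite sqrtr_gt0. Qed.

Let sigma_neq0 : sigma != 0. Proof. by rewrite gt_eqF ?sigma_gt0. Qed.

Lemma copy_weight_ge0 s : 0 <= m s.
Proof.
rewrite /m; case: ifP => // _; rewrite divr_ge0 ?(ltW sigma_gt0) // mulr_ge0 ?invr_ge0 //.
by apply: prodr_ge0 => ij _.
Qed.

Lemma card_image_set s : (#|c s| <= k)%N.
Proof. by rewrite cardsE -[leqRHS](card_ord k) leq_image_card. Qed.

Lemma q_image_set s : injectiveb s -> q (c s) = p ^+ k.
Proof. by move=> /injectiveP si; rewrite /q cardsE card_codom // card_ord. Qed.

Lemma subset_image_set A s : (A \subset c s) = (A \subset codom s).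
Proof. by apply: eq_subset_r => x; rewrite inE. Qed.

Lemma XsE w s : Xs R w s = allon R (c s) w.
Proof.
rewrite /Xs /allon; have [/subsetP sub|/subsetPn[x]] := boolP (_ \subset _).
  by rewrite big1 // => u _; have := sub (s u); rewrite !inE codom_f => ->.
rewrite !inE => /codomP[u ->] wu; rewrite (bigD1 u) //= (negPf wu) mul0r //.
Qed.

Lemma sum_copies (f : I -> R) :
  (num_aut eH)%:R^-1 * (\sum_(s : I | injectiveb s) MH R adj eH s * f s) = sigma * wsum m f.
Proof.
rewrite /wsum !mulr_sumr big_mkcond; apply: eq_bigr => s _; rewrite /m.
case: ifP => _; last by rewrite mul0r mulr0.
by rewrite [LHS]mulrA; move: (_ * MH _ _ _ _) => x; field; rewrite gt_eqF ?sigma_gt0.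
Qed.

Lemma THE w : TH R adj eH w = sigma * wsum m (fun s => allon R (c s) w).
Proof. by rewrite -sum_copies; congr (_ * _); apply: eq_bigr => s _; rewrite XsE. Qed.

Lemma Ex_TH : E (TH R adj eH) = sigma * wsum m (fun s => q (c s)).
Proof.
rewrite (eq_Ex _ THE) ExZ (Ex_wsum _ _ (fun s => allon R (c s))); congr (_ * _).
by apply: eq_wsum => s; rewrite Ex_allon.
Qed.

Lemma NHE : p ^+ k * NH R adj eH = sigma * wsum m (fun s => q (c s)).
Proof.
rewrite -sum_copies mulrCA; congr (_ * _); rewrite mulr_sumr; apply: eq_bigr => s si.
by rewrite q_image_set // mulrC.
Qed.

Lemma ZHE w : ZH adj eH p w = csum p c m w.
Proof.
rewrite /ZH NHE THE -mulrBr mulrAC divff ?mul1r ?gt_eqF ?sigma_gt0 // -wsumB.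
exact: eq_wsum.
Qed.

Lemma variance_copies : csum_var p c m = 1.
Proof.
have -> : csum_var p c m = E (fun w => (TH R adj eH w - E (TH R adj eH)) ^+ 2 / VarT adj eH p).
  apply: eq_Ex => w; rewrite -ZHE /ZH NHE -Ex_TH expr_div_n sqr_sqrtr //; exact: ltW.
rewrite ExZr; set mu := E (TH R adj eH).
have -> : E (fun w => (TH R adj eH w - mu) ^+ 2) = VarT adj eH p.
  transitivity (E (fun w => TH R adj eH w ^+ 2 - (2 * mu) * TH R adj eH w + mu ^+ 2)).
    by apply: eq_Ex => w; ring.
  by rewrite ExD ExB ExZ Ex_cst -/mu /VarT -/mu; ring.
by rewrite divff // gt_eqF.
Qed.

Lemma local_massE A : local_mass p c m A = p ^+ k * tH R adj eH A / sigma.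
Proof.
apply: (mulfI sigma_neq0).
rewrite [RHS]mulrC divfK ?gt_eqF ?sigma_gt0 // -sum_copies mulrCA; congr (_ * _).
rewrite mulr_sumr big_mkcondr; apply: eq_bigr => s si.
rewrite subset_image_set q_image_set //; case: (_ \subset _); first by rewrite mul1r mulrC.
by rewrite mul0r !mulr0.
Qed.

Lemma CME M A : A != set0 -> CM adj eH p M A = heavy p c m M A.
Proof.
move=> A0; rewrite /CM /heavy A0 local_massE /q.
have pk : p ^+ k != 0 by rewrite expf_neq0 // gt_eqF.
have s0 : sigma != 0 by rewrite gt_eqF // sigma_gt0.
have -> : VarT adj eH p = sigma ^+ 2 by rewrite sqr_sqrtr // ltW.
(* The integer exponent is negative for |A| < k, so the power is rewritten as a quotient of natural
   powers. *)
have -> : p ^ ((2 * #|A|)%:Z - (2 * k)%:Z) = (p ^+ #|A|) ^+ 2 / (p ^+ k) ^+ 2.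
  by rewrite expfzDr ?gt_eqF // -exprnN -exprnP -!exprM !(mulnC 2).
set a := p ^+ #|A|; set b := p ^+ k in pk *; set t := tH _ _ _ _.
rewrite -(ltr_pM2r (_ : 0 < b ^+ 2 / sigma ^+ 2)); last first.
  by rewrite divr_gt0 // exprn_gt0 // ?sigma_gt0 // exprn_gt0.
congr (_ < _); field; rewrite ?s0 ?pk //.
Qed.

Lemma goodME M s : goodM adj eH p M s = light_index p c m M s.
Proof.
apply/forallP/forallP => H A; have := H A; rewrite subset_image_set.
  have [->|A0] := eqVneq A set0; first by rewrite /heavy eqxx implybT.
  by rewrite CME.
have [//|A0] := eqVneq A set0; by rewrite CME.
Qed.

Lemma TME M w : TM adj eH p M w =
  sigma * wsum (light_weight p c m M) (fun s => allon R (c s) w).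
Proof.
transitivity ((num_aut eH)%:R^-1 * (\sum_(s : I | injectiveb s)
    MH R adj eH s * ((light_index p c m M s)%:R * allon R (c s) w))).
  by congr (_ * _); apply: eq_bigr => s _; rewrite XsE goodME mulrAC mulrA.
by rewrite sum_copies wsum_light.
Qed.

Lemma ZME M w : ZM adj eH p M w = csum p c (light_weight p c m M) w.
Proof.
have e : E (TM adj eH p M) = sigma * wsum (light_weight p c m M) (fun s => q (c s)).
  rewrite (eq_Ex _ (TME M)) ExZ (Ex_wsum _ _ (fun s => allon R (c s))); congr (_ * _).
  by apply: eq_wsum => s; rewrite Ex_allon.
rewrite /ZM e TME -mulrBr mulrAC divff ?mul1r ?gt_eqF ?sigma_gt0 // -wsumB.
exact: eq_wsum.
Qed.

End SubgraphCounts.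

From mathcomp Require Import all_classical all_reals all_analysis measurable_realfun.
Import numFieldNormedType.Exports.
Local Open Scope classical_set_scope.

(** * Derivatives and Taylor bounds on the line *)

Section Derivatives.
Variable R : realType.
Implicit Types (f g : R -> R) (x y a b : R).

Lemma has_derive_eq f x a b : is_derive x 1 f a -> a = b -> is_derive x 1 f b.
Proof. by move=> ? <-. Qed.

Lemma has_derive_mul f g x a b : is_derive x 1 f a -> is_derive x 1 g b ->
  is_derive x 1 (fun y => f y * g y) (a * g x + f x * b).
Proof.
move=> fa gb; apply: has_derive_eq (@is_deriveM _ _ f g x 1 a b fa gb) _.
by rewrite /GRing.scale /= addrC (mulrC (g x)).
Qed.

Lemma has_derive_add f g x a b : is_derive x 1 f a -> is_derive x 1 g b ->
  is_derive x 1 (fun y => f y + g y) (a + b).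
Proof. by move=> fa gb; apply: is_deriveD. Qed.

Lemma has_derive_sub f g x a b : is_derive x 1 f a -> is_derive x 1 g b ->
  is_derive x 1 (fun y => f y - g y) (a - b).
Proof. by move=> fa gb; apply: is_deriveB. Qed.

Lemma has_derive_opp f x a : is_derive x 1 f a -> is_derive x 1 (fun y => - f y) (- a).
Proof. by move=> fa; apply: is_deriveN. Qed.

Lemma has_derive_cst a x : is_derive x 1 (fun _ : R => a) (0 : R).
Proof. exact: is_derive_cst. Qed.

Lemma has_derive_idfun x : is_derive x 1 (fun y : R => y) (1 : R).
Proof. exact: is_derive_id. Qed.

Lemma has_derive_comp f g x a b : is_derive (g x) 1 f a -> is_derive x 1 g b ->
  is_derive x 1 (fun y => f (g y)) (a * b).
Proof. by move=> fa gb; apply: is_derive1_comp. Qed.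

Lemma has_derive_inv f x a : f x != 0 -> is_derive x 1 f a ->
  is_derive x 1 (fun y => (f y)^-1) (- a * (f x) ^- 2).
Proof.
move=> fx0 fa; apply: has_derive_eq (@is_deriveV _ f x a 1 fx0 fa) _.
by rewrite /GRing.scale /= mulrC mulrN mulNr.
Qed.

Lemma has_derive_exp f x a : is_derive x 1 f a ->
  is_derive x 1 (fun y => expR (f y)) (a * expR (f x)).
Proof.
by move=> fa; apply: has_derive_eq (has_derive_comp (is_derive_expR _) fa) _; rewrite mulrC.
Qed.

Lemma has_derive_continuous f x a : is_derive x 1 f a -> {for x, continuous f}.
Proof. by move=> [fa _]; apply/differentiable_continuous/derivable1_diffP. Qed.

Lemma derive_mean_value f df a b : a <= b ->
  (forall x, a <= x <= b -> is_derive x 1 f (df x)) ->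
  exists2 x, a <= x <= b & f b - f a = df x * (b - a).
Proof.
move=> ab fdf; have [||x] := @MVT_segment R f df a b ab.
- by move=> x; rewrite in_itv /= => /andP[??]; apply: fdf; rewrite !ltW.
- apply: continuous_in_subspaceT => x; rewrite inE /= in_itv /= => xab.
  exact: has_derive_continuous (fdf x xab).
- by rewrite in_itv /=; exists x.
Qed.

Lemma derive_nondecreasing f df a b : a <= b ->
  (forall x, a <= x <= b -> is_derive x 1 f (df x)) ->
  (forall x, a <= x <= b -> 0 <= df x) -> f a <= f b.
Proof.
move=> ab fdf df0; have [x xab e] := derive_mean_value ab fdf.
by rewrite -subr_ge0 e mulr_ge0 ?df0 ?subr_ge0.
Qed.

Lemma derive_lipschitz f df L : (forall x, is_derive x 1 f (df x)) ->
  (forall x, `|df x| <= L) -> forall x y, `|f x - f y| <= L * `|x - y|.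
Proof.
move=> fdf dfL x y; wlog xy : x y / y <= x => [H|].
  by case/orP: (le_total y x) => [/H//|/H]; rewrite distrC (distrC y).
have [z _ ->] := derive_mean_value xy (fun z _ => fdf z).
by rewrite normrM ler_wpM2r.
Qed.

Lemma derive_taylor f df L : (forall x, is_derive x 1 f (df x)) ->
  (forall x y, `|df x - df y| <= L * `|x - y|) ->
  forall x y, `|f y - f x - (y - x) * df y| <= L * (y - x) ^+ 2.
Proof.
move=> fdf dfL x y.
have [z zxy e] : exists2 z, `|z - y| <= `|y - x| & f y - f x = df z * (y - x).
  case/orP: (le_total x y) => xy.
    have [z /andP[xz zy] ->] := derive_mean_value xy (fun z _ => fdf z).
    by exists z => //; rewrite distrC !ger0_norm ?subr_ge0 // lerD2l lerN2.
  have [z /andP[xz zy] e] := derive_mean_value xy (fun z _ => fdf z).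
  exists z; last by rewrite -[LHS]opprB e -mulrN opprB.
  by rewrite (distrC y) !ger0_norm ?subr_ge0 // lerD2r.
rewrite e mulrC -mulrBr normrM -real_normK ?num_real // expr2 mulrCA ler_wpM2l //.
have L0 : 0 <= L by have := le_trans (normr_ge0 _) (dfL 1 0); rewrite subr0 normr1 mulr1.
by apply: le_trans (dfL z y) _; rewrite ler_wpM2l.
Qed.

End Derivatives.

(** * The standard normal density and distribution function *)

Section Gaussian.
Variable R : realType.
Implicit Types (h : R -> R) (x y t : R).
Local Notation mu := (@lebesgue_measure R).
Local Notation phi := (@normal_pdf R 0 1).

Lemma phiE x : phi x = normal_peak 1 * expR (- (x ^+ 2 / 2)).
Proof. by rewrite normal_pdfE ?oner_eq0 // /normal_fun subr0 expr1n mulNr. Qed.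

Let peak_gt0 : 0 < normal_peak 1 :> R.
Proof. by rewrite normal_peak_gt0 // oner_eq0. Qed.

Lemma phi_gt0 x : 0 < phi x.
Proof. by rewrite phiE mulr_gt0 ?expR_gt0. Qed.

Lemma has_derive_phi x : is_derive x 1 phi (- x * phi x).
Proof.
have -> : phi = fun y => normal_peak 1 * expR (- 2^-1 * (y * y)).
  by apply/funext => y; rewrite phiE -expr2; congr (_ * expR _); ring.
apply: has_derive_eq (has_derive_mul (has_derive_cst _ _)
  (has_derive_exp (has_derive_mul (has_derive_cst _ _)
  (has_derive_mul (has_derive_idfun _) (has_derive_idfun _))))) _.
by rewrite /=; field.
Qed.

Section Weight.
Variable h : R -> R.
Hypothesis h01 : forall x, 0 <= h x <= 1.
Hypothesis h_cont : continuous h.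

Definition gauss_int (B : set R) : R := \int[mu]_(x in B) (h x * phi x).

Lemma phi_integrable (B : set R) : measurable B -> mu.-integrable B (EFin \o phi).
Proof.
move=> mB; have := @integrable_normal_pdf R 0 1; apply: integrableS => //.
Qed.

Lemma h_phi_integrable (B : set R) : measurable B ->
  mu.-integrable B (EFin \o (fun x => h x * phi x)).
Proof.
move=> mB; apply: le_integrable (phi_integrable mB) => //.
  apply/measurable_EFinP/measurable_funM.
    by apply: measurable_funTS; apply: continuous_measurable_fun.
  by apply: measurable_funTS; apply: measurable_normal_pdf.
move=> x _ /=; rewrite lee_fin normrM ler_piMl //.
by case/andP: (h01 x) => h0 h1; rewrite ger0_norm.
Qed.

Lemma gauss_int_ge0 B : 0 <= gauss_int B.
Proof.
apply: Rintegral_ge0 => x _; apply: mulr_ge0; last exact/ltW/phi_gt0.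
by case/andP: (h01 x).
Qed.

Lemma has_derive_gauss_int x : is_derive x 1 (fun y => gauss_int `]-oo, y]) (h x * phi x).
Proof.
have [||||D1 D2] := @continuous_FTC1 R (fun x => h x * phi x) -oo%O x (x + 1).
- by rewrite ltrDl.
- by apply: h_phi_integrable.
- by rewrite ltNyr.
- apply: cvgM; first exact: h_cont.
  exact: (has_derive_continuous (has_derive_phi x)).
- split; first exact: D1.
  by rewrite -D2 derive1E.
Qed.

Lemma gauss_int_split x : gauss_int setT = gauss_int `]-oo, x] + gauss_int `]x, +oo[.
Proof.
rewrite /gauss_int -set_itvNyy.
rewrite -(@Rintegral_itvB R _ -oo%O +oo%O x) //; last exact: h_phi_integrable.
by rewrite addrC subrK.
Qed.

End Weight.

Lemma gauss_int_le h1 h2 B : measurable B -> continuous h1 -> continuous h2 ->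
  (forall x, 0 <= h1 x <= 1) -> (forall x, 0 <= h2 x <= 1) ->
  (forall x, B x -> h1 x <= h2 x) -> gauss_int h1 B <= gauss_int h2 B.
Proof.
move=> mB c1 c2 b1 b2 h12; apply: le_Rintegral => //.
- exact: h_phi_integrable.
- exact: h_phi_integrable.
- by move=> x Bx; rewrite ler_wpM2r ?h12 // ltW // phi_gt0.
Qed.

Let one01 (x : R) : 0 <= (cst 1 : R -> R) x <= 1. Proof. by rewrite ler01 lexx. Qed.
Let one_cont : continuous (cst 1 : R -> R). Proof. exact: cst_continuous. Qed.

Lemma gauss_int1 B : gauss_int (cst 1) B = fine (normal_prob 0 1 B : \bar R).
Proof. by rewrite /gauss_int /Rintegral; under eq_integral do rewrite mul1r. Qed.

Lemma PhiE t : Phi t = gauss_int (cst 1) `]-oo, t].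
Proof. by rewrite gauss_int1. Qed.

Lemma gauss_int_setT : gauss_int (cst 1) setT = 1.
Proof. by rewrite gauss_int1 probability_setT. Qed.

Lemma Phi_compl t : 1 - Phi t = gauss_int (cst 1) `]t, +oo[.
Proof.
by rewrite PhiE -[X in X - _]gauss_int_setT (gauss_int_split _ _ t) // addrAC subrr add0r.
Qed.

Lemma Phi_ge0 t : 0 <= Phi t. Proof. by rewrite PhiE gauss_int_ge0. Qed.

Lemma Phi_le1 t : Phi t <= 1. Proof. by rewrite -subr_ge0 Phi_compl gauss_int_ge0. Qed.

Lemma has_derive_Phi t : is_derive t 1 (@Phi R) (phi t).
Proof.
have -> : @Phi R = fun t => gauss_int (cst 1) `]-oo, t] by apply/funext => y; rewrite PhiE.
by apply: has_derive_eq (has_derive_gauss_int one01 one_cont t) _; rewrite mul1r.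
Qed.

(** Under [normal_prob 0 1] the identity is a random variable with distribution function [Phi], so
    the general limits of distribution functions apply. *)
Let idR : measurableTypeR R -> R := idfun.

#[local] HB.instance Definition _ :=
  @isMeasurableFun.Build _ _ _ _ idR (@measurable_id _ _ setT).

Let cdf_normal x : cdf (idR : {RV (normal_prob 0 1 : probability _ R) >-> R}) x = (Phi x)%:E.
Proof. by rewrite /Phi fineK // fin_num_measure. Qed.

Lemma Phi_cvgNy : Phi x @[x --> -oo] --> (0 : R).
Proof.
have := cvg_cdfNy0 (idR : {RV (normal_prob 0 1 : probability _ R) >-> R}).
rewrite (_ : cdf _ = (fun x => (Phi x)%:E)); first by move/fine_cvg.
by apply/funext => x; exact: cdf_normal.
Qed.

Lemma Phi_cvgy : Phi x @[x --> +oo] --> (1 : R).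
Proof.
have := cvg_cdfy1 (idR : {RV (normal_prob 0 1 : probability _ R) >-> R}).
rewrite (_ : cdf _ = (fun x => (Phi x)%:E)); first by move/fine_cvg.
by apply/funext => x; exact: cdf_normal.
Qed.

Lemma Phi_lipschitz x y : `|Phi x - Phi y| <= normal_peak 1 * `|x - y|.
Proof.
apply: (derive_lipschitz has_derive_Phi) => z.
by rewrite ger0_norm ?(ltW (phi_gt0 _)) // normal_pdf_ub // oner_eq0.
Qed.

(** Mills' inequality: on the negative axis phi(z) / (-z) - Phi(z) has derivative phi(z) / z^2 >= 0.
    Comparing x with y below it, and letting y tend to minus infinity, gives the bound. *)
Lemma mills_neg x : x < 0 -> - x * Phi x <= phi x.
Proof.
move=> x0; have mx : 0 < - x by rewrite oppr_gt0.
rewrite mulrC -ler_pdivlMr //.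
have H y : y <= x -> Phi x <= phi x / - x + Phi y.
  move=> yx; suff : phi y * (- y)^-1 - Phi y <= phi x * (- x)^-1 - Phi x.
    have : 0 <= phi y * (- y)^-1.
      by rewrite mulr_ge0 ?invr_ge0 ?(ltW (phi_gt0 _)) // oppr_ge0 (le_trans yx) ?ltW.
    by rewrite lerBrDr; lra.
  have neg z : y <= z <= x -> z < 0 by case/andP => _ /le_lt_trans; apply.
  apply: (derive_nondecreasing yx (f := fun z => phi z * (- z)^-1 - Phi z)
    (df := fun z => phi z * (z * z)^-1)) => z yzx.
    have z0 : z != 0 by rewrite lt_eqF ?neg.
    have nz0 : - z != 0 by rewrite oppr_eq0.
    have D := has_derive_mul (has_derive_phi z)
      (has_derive_inv nz0 (has_derive_opp (has_derive_idfun z))).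
    apply: has_derive_eq (has_derive_sub D (has_derive_Phi z)) _.
    by field.
  by rewrite mulr_ge0 ?invr_ge0 ?(ltW (phi_gt0 _)) // -expr2 sqr_ge0.
apply/ler_addgt0Pr => e e0; near (-oo : set_system R) => y.
apply: le_trans (H y _) _; first by near: y; apply: nbhs_ninfty_le; rewrite num_real.
by rewrite lerD2l; near: y; apply: (cvgr_le _ Phi_cvgNy).
Unshelve. all: by end_near. Qed.

Lemma mills_pos x : 0 < x -> x * (1 - Phi x) <= phi x.
Proof.
move=> x0; rewrite mulrC -ler_pdivlMr //.
have H y : x <= y -> 1 - Phi x <= phi x / x + (1 - Phi y).
  move=> xy; suff : - (phi x * x^-1) - Phi x <= - (phi y * y^-1) - Phi y.
    have : 0 <= phi y * y^-1.
      by rewrite mulr_ge0 ?invr_ge0 ?(ltW (phi_gt0 _)) // ltW // (lt_le_trans x0).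
    lra.
  have pos z : x <= z <= y -> 0 < z by case/andP => /(lt_le_trans x0).
  apply: (derive_nondecreasing xy (f := fun z => - (phi z * z^-1) - Phi z)
    (df := fun z => phi z * (z * z)^-1)) => z xzy.
    have z0 : z != 0 by rewrite gt_eqF ?pos.
    have D := has_derive_mul (has_derive_phi z) (has_derive_inv z0 (has_derive_idfun z)).
    apply: has_derive_eq (has_derive_sub (has_derive_opp D) (has_derive_Phi z)) _.
    by field.
  by rewrite mulr_ge0 ?invr_ge0 ?(ltW (phi_gt0 _)) // -expr2 sqr_ge0.
apply/ler_addgt0Pr => e e0; near (+oo : set_system R) => y.
apply: le_trans (H y _) _; first by near: y; apply: nbhs_pinfty_ge; rewrite num_real.
rewrite lerD2l lerBlDr -lerBlDl; near: y; apply: (cvgr_ge _ Phi_cvgy).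
by rewrite ltrBlDr ltrDl.
Unshelve. all: by end_near. Qed.

End Gaussian.

(** * Stein's equation and a cutoff of its solution *)

Section SteinSolution.
Variables (R : realType) (h h' : R -> R) (B eps : R).
Hypothesis h01 : forall x, 0 <= h x <= 1.
Hypothesis derive_h : forall x : R, is_derive x 1 h (h' x).
Hypothesis h'_le : forall x, `|h' x| <= B.
Hypothesis eps_gt0 : 0 < eps.
Local Notation phi := (@normal_pdf R 0 1).
Local Notation H x := (gauss_int h `]-oo, x]).
Local Notation mean := (gauss_int h setT).
Local Notation Phi := (@Phi R).

Let h_cont : continuous h. Proof. by move=> x; apply: has_derive_continuous (derive_h x). Qed.

Let one01 (x : R) : 0 <= (cst 1 : R -> R) x <= 1. Proof. by rewrite ler01 lexx. Qed.
Let one_cont : continuous (cst 1 : R -> R). Proof. exact: cst_continuous. Qed.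

Lemma mean01 : 0 <= mean <= 1.
Proof.
rewrite gauss_int_ge0 //= -[leRHS](gauss_int_setT R); apply: gauss_int_le => // x _.
by case/andP: (h01 x).
Qed.

(** The classical solution of f'(x) - x f(x) = h(x) - mean, namely the integral of (h - mean) phi up
    to x, divided by phi(x). *)
Let f x : R := (H x - mean * Phi x) * (phi x)^-1.

Let phi_neq0 x : phi x != 0. Proof. by rewrite gt_eqF ?phi_gt0. Qed.

Let derive_f (x : R) : is_derive x 1 f (h x - mean + x * f x).
Proof.
have DH := has_derive_gauss_int h01 h_cont x.
have DP := has_derive_mul (has_derive_cst mean x) (has_derive_Phi x).
have D := has_derive_mul (has_derive_sub DH DP) (has_derive_inv (phi_neq0 x) (has_derive_phi x)).
apply: has_derive_eq D _.
by rewrite /f; field.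
Qed.

Let numer_le_Phi x : `|H x - mean * Phi x| <= Phi x.
Proof.
have /andP[c0 c1] := mean01; have P0 := Phi_ge0 x.
have H0 : 0 <= H x by apply: gauss_int_ge0.
have H1 : H x <= Phi x.
  by rewrite PhiE; apply: gauss_int_le => // y _; case/andP: (h01 y).
by rewrite ler_norml; apply/andP; split; nra.
Qed.

Let numer_le_compl x : `|H x - mean * Phi x| <= 1 - Phi x.
Proof.
have /andP[c0 c1] := mean01; have P0 : 0 <= 1 - Phi x by rewrite subr_ge0 Phi_le1.
have e : mean - H x = gauss_int h `]x, +oo[.
  by rewrite (gauss_int_split h01 h_cont x) addrAC subrr add0r.
have H0 : 0 <= mean - H x by rewrite e gauss_int_ge0.
have H1 : mean - H x <= 1 - Phi x.
  by rewrite e Phi_compl; apply: gauss_int_le => // y _; case/andP: (h01 y).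
by rewrite ler_norml; apply/andP; split; nra.
Qed.

(** The numerator is bounded by both Gaussian tails; on each half-line Mills' inequality applies to
    the smaller one. *)
Let xf_le x : `|x * f x| <= 1.
Proof.
have p0 := phi_gt0 x.
rewrite /f mulrA normrM (ger0_norm (x := _^-1)) ?invr_ge0 ?(ltW p0) // ler_pdivrMr // mul1r normrM.
have [x0|x0|->] := ltrgt0P x; last by rewrite ?normr0 mul0r ltW // phi_gt0.
  by apply: le_trans (mills_pos x0); rewrite ler_wpM2l // ltW.
by apply: le_trans (mills_neg x0); rewrite ler_wpM2l // oppr_ge0 ltW.
Qed.

Let f_le x : `|f x| <= 1 + (phi 1)^-1.
Proof.
have i0 : 0 < (phi 1)^-1 by rewrite invr_gt0 phi_gt0.
have [x1|x1] := lerP 1 `|x|.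
  apply: le_trans (_ : 1 <= _); last by rewrite lerDl ltW.
  by apply: le_trans (xf_le x); rewrite [leRHS]normrM ler_peMl.
apply: le_trans (_ : (phi 1)^-1 <= _); last by rewrite lerDr.
have px : phi 1 <= phi x.
  rewrite !phiE ler_wpM2l ?normal_peak_ge0 // ler_expR lerN2 ler_pM2r ?invr_gt0 //.
  by rewrite -real_normK ?num_real // ler_pXn2r ?nnegrE // ltW.
rewrite /f normrM (ger0_norm (x := _^-1)) ?invr_ge0 ?(ltW (phi_gt0 _)) //.
rewrite -[leRHS]mul1r ler_pM ?invr_ge0 ?(ltW (phi_gt0 _)) //.
  by apply: le_trans (numer_le_Phi x) _; rewrite Phi_le1.
by rewrite lef_pV2 ?posrE ?phi_gt0.
Qed.

(* The solution [f] of Stein's equation has an unbounded second derivative; the cutoff [chi]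
   makes the derivative of [f * chi] Lipschitz at the cost of an error [eps * x ^+ 2]. *)
Let chi x : R := (1 + eps * (x * x))^-1.

Let chi_den x : 0 < 1 + eps * (x * x).
Proof. by have := mulr_ge0 (ltW eps_gt0) (sqr_ge0 x); rewrite expr2; lra. Qed.

Let chi_gt0 x : 0 < chi x. Proof. by rewrite invr_gt0. Qed.

Let chi_le1 x : chi x <= 1.
Proof.
by rewrite invf_le1 //; have := mulr_ge0 (ltW eps_gt0) (sqr_ge0 x); rewrite expr2; lra.
Qed.

Let derive_chi (x : R) : is_derive x 1 chi (- (2 * eps * x) * chi x ^+ 2).
Proof.
have d0 : 1 + eps * (x * x) != 0 by rewrite gt_eqF.
have D := has_derive_add (has_derive_cst 1 x) (has_derive_mul (has_derive_cst eps x)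
  (has_derive_mul (has_derive_idfun x) (has_derive_idfun x))).
apply: has_derive_eq (has_derive_inv (f := fun y => 1 + eps * (y * y)) d0 D) _.
by rewrite /chi; field.
Qed.

Let X : R := 1 + eps^-1.

Let xchi_le x : `|x * chi x| <= X.
Proof.
rewrite normrM (ger0_norm (ltW (chi_gt0 x))) ler_pdivrMr //.
have i0 : 0 < eps^-1 by rewrite invr_gt0.
have e : eps^-1 * (eps * (x * x)) = x * x by rewrite mulKf ?gt_eqF.
have s : x * x = `|x| * `|x| by rewrite -!expr2 real_normK ?num_real.
have := mulr_ge0 (ltW eps_gt0) (sqr_ge0 x); rewrite expr2 /X mulrDl mul1r mulrDr mulr1 e s.
by have := normr_ge0 x; nra.
Qed.

Lemma stein_solution : exists F F' : R -> R, exists L1 L2 : R,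
  [/\ 0 <= L1, 0 <= L2, forall x, `|F' x| <= L1,
      forall x y, `|F y - F x - (y - x) * F' y| <= L2 * (y - x) ^+ 2 &
      forall x, `|F' x - x * F x - (h x - mean)| <= eps * x ^+ 2 + 2 * eps].
Proof.
pose a x := h x - mean + x * f x.
have a_le x : `|a x| <= 2.
  have /andP[c0 c1] := mean01; have /andP[h0 h1] := h01 x.
  have := xf_le x; rewrite !ler_norml /a => /andP[? ?]; apply/andP; split; lra.
have derive_a (x : R) : is_derive x 1 a (h' x + (f x + x * a x)).
  apply: has_derive_eq (has_derive_add (has_derive_sub (derive_h x) (has_derive_cst mean x))
    (has_derive_mul (has_derive_idfun x) (derive_f x))) _.
  by rewrite /a subr0 mul1r.
pose F x := f x * chi x.
(* The derivative is grouped into factors that are bounded one by one: [a], [chi], [x * chi x] and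
   [f x * chi x]. The same grouping bounds its derivative [G]. *)
pose F' x := a x * chi x + - (2 * eps) * ((x * chi x) * (f x * chi x)).
have derive_F (x : R) : is_derive x 1 F (F' x).
  apply: has_derive_eq (has_derive_mul (derive_f x) (derive_chi x)) _; rewrite /F' /a; ring.
have c_le x : `|chi x| <= 1 by rewrite ger0_norm // ltW.
have C0 : 0 <= 1 + (phi 1)^-1 by rewrite addr_ge0 // invr_ge0 ltW // phi_gt0.
have X0 : 0 <= X by rewrite addr_ge0 // invr_ge0 ltW.
set C := 1 + (phi 1)^-1 in C0.
have fchi_le x : `|f x * chi x| <= C.
  by rewrite normrM -[C]mulr1 ler_pM ?f_le.
have e0 := ltW eps_gt0.
have two : `|- (2 * eps)| = 2 * eps by rewrite normrN ger0_norm // mulr_ge0.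
have F'_le x : `|F' x| <= 2 + 2 * eps * (X * C).
  apply: le_trans (ler_normD _ _) _; apply: lerD.
    by rewrite normrM -[2]mulr1 ler_pM.
  by rewrite normrM two ler_wpM2l ?mulr_ge0 // normrM ler_pM.
pose chi' x := - (2 * eps * x) * chi x ^+ 2.
have chi'_le x : `|chi' x| <= 2 * eps * X.
  rewrite (_ : chi' x = - (2 * eps) * ((x * chi x) * chi x)); last by rewrite /chi'; ring.
  rewrite normrM two ler_wpM2l ?mulr_ge0 // normrM -[X]mulr1 ler_pM //.
pose G x := (h' x * chi x + f x * chi x + a x * (x * chi x)) + a x * chi' x +
  - (2 * eps) * ((chi x + x * chi' x) * (f x * chi x) + (x * chi x) * F' x).
have derive_F' (x : R) : is_derive x 1 F' (G x).
  apply: has_derive_eq (has_derive_add (has_derive_mul (derive_a x) (derive_chi x)) (has_derive_mul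
    (has_derive_cst (- (2 * eps)) x) (has_derive_mul (has_derive_mul (has_derive_idfun x) (derive_chi x))
    (derive_F x)))) _.
  rewrite /G /F' /F /chi' /a; ring.
have xchi'_le x : `|x * chi' x| <= 2 * eps * (X * X).
  rewrite (_ : x * chi' x = - (2 * eps) * ((x * chi x) * (x * chi x))); last first.
    by rewrite /chi'; ring.
  by rewrite normrM two ler_wpM2l ?mulr_ge0 // normrM ler_pM.
pose L2 := (B + C + 2 * X) + 2 * (2 * eps * X) +
  2 * eps * ((1 + 2 * eps * (X * X)) * C + X * (2 + 2 * eps * (X * C))).
have G_le x : `|G x| <= L2.
  have addb (u v b1 b2 : R) : `|u| <= b1 -> `|v| <= b2 -> `|u + v| <= b1 + b2.
    by move=> u1 v1; apply: le_trans (ler_normD _ _) (lerD u1 v1).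
  have mulb (u v b1 b2 : R) : `|u| <= b1 -> `|v| <= b2 -> `|u * v| <= b1 * b2.
    by move=> u1 v1; rewrite normrM ler_pM.
  apply: (addb); [apply: (addb); [apply: (addb); [apply: (addb)|]|]|].
  - by rewrite -[B]mulr1; apply: (mulb).
  - exact: fchi_le.
  - exact: (mulb).
  - exact: (mulb).
  - apply: (mulb); first by rewrite two.
    apply: (addb); last exact: (mulb).
    by apply: (mulb) => //; apply: (addb).
have L20 : 0 <= L2 by apply: le_trans (G_le 0).
exists F, F', (2 + 2 * eps * (X * C)), L2; split=> //.
- by rewrite addr_ge0 // !mulr_ge0.
- by apply: (derive_taylor derive_F); apply: derive_lipschitz derive_F' G_le.
- move=> x.
  (* The cutoff errs by (1 - chi)(h - mean), where 1 - chi is at most [eps * x ^+ 2], and by f chi',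
     which is at most [2 * eps] because |x f| <= 1. *)
  have -> : F' x - x * F x - (h x - mean) =
      - ((1 - chi x) * (h x - mean)) + - (2 * eps) * ((x * f x) * chi x ^+ 2).
    by rewrite /F' /F /a; ring.
  apply: le_trans (ler_normD _ _) _; apply: lerD.
    have /andP[c0 c1] := mean01; have /andP[h0 h1] := h01 x.
    have hm : `|h x - mean| <= 1 by rewrite ler_norml; apply/andP; split; lra.
    rewrite normrN normrM -[leRHS]mulr1 ler_pM // ger0_norm ?subr_ge0 //.
    rewrite (_ : 1 - chi x = eps * x ^+ 2 * chi x); last first.
      by rewrite /chi expr2; field; rewrite gt_eqF.
    by rewrite ler_piMr // mulr_ge0 ?sqr_ge0.
  rewrite normrM two -[leRHS]mulr1 ler_wpM2l ?mulr_ge0 // normrM -[1]mulr1 ler_pM //.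
  by rewrite normrX exprn_ile1.
Qed.

End SteinSolution.

(** * Stein's equation for smoothed indicators *)

Section SteinIndicator.
Variable R : realType.
Local Notation Phi := (@Phi R).

Let one01 (x : R) : 0 <= (cst 1 : R -> R) x <= 1. Proof. by rewrite ler01 lexx. Qed.
Let one_cont : continuous (cst 1 : R -> R). Proof. exact: cst_continuous. Qed.

Lemma gauss_int_cst (a : R) B : measurable B ->
  gauss_int (cst a) B = a * gauss_int (cst 1) B.
Proof.
move=> mB; rewrite /gauss_int -RintegralZl //; last by apply: h_phi_integrable.
by apply: eq_Rintegral => x _; rewrite mul1r.
Qed.

(** The slope [lam] confines the transition of the logistic function from above 1 - eta to below eta
    to the interval between u - s and u + s. In the final error 4 = 2 + 1 + 1: cutoff, indicator and
    mean. *)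
Lemma stein_indicator (u s eta : R) : 0 < s -> 0 < eta < 1 ->
  exists F F' : R -> R, exists L1 L2 : R,
  [/\ 0 <= L1, 0 <= L2, forall x, `|F' x| <= L1,
      forall x y, `|F y - F x - (y - x) * F' y| <= L2 * (y - x) ^+ 2 &
      forall x : R, (x <= u - s)%R%:R - Phi (u + s) - eta * (x ^+ 2 + 4) <= F' x - x * F x
        /\ F' x - x * F x <= (x <= u + s)%R%:R - Phi (u - s) + eta * (x ^+ 2 + 4)].
Proof.
move=> s0 /andP[eta0 eta1].
(* a logistic approximation of the indicator of [x <= u] *)
pose lam := - ln eta / s; pose g x := expR (lam * (x - u)); pose h x := (1 + g x)^-1.
have lam0 : 0 < lam by rewrite divr_gt0 // oppr_gt0 ln_lt0 // eta0.
have els : expR (- (lam * s)) = eta by rewrite /lam divfK ?gt_eqF // opprK lnK.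
have g0 x : 0 < g x by apply: expR_gt0.
have d0 x : 0 < 1 + g x by rewrite addr_gt0.
have h0 x : 0 < h x by rewrite invr_gt0.
have h1 x : h x <= 1 by rewrite invf_le1 // lerDl ltW.
have h01 x : 0 <= h x <= 1 by rewrite ltW //=.
have hl (x : R) : x <= u - s -> 1 - eta <= h x.
  move=> xs; have gx : g x <= eta.
    by rewrite -els ler_expR -mulrN ler_pM2l //; lra.
  by rewrite -[h x]mul1r ler_pdivlMr //; have := g0 x; nra.
have hr (x : R) : u + s <= x -> h x <= eta.
  move=> xs; have gx : eta^-1 <= g x.
    by rewrite -els -expRN opprK ler_expR ler_pM2l //; lra.
  by rewrite -[eta]invrK lef_pV2 ?posrE ?invr_gt0 //; lra.
pose h' x := - (lam * g x) * h x ^+ 2.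
have dh (x : R) : is_derive x 1 h (h' x).
  have D := has_derive_exp (has_derive_mul (has_derive_cst lam x)
    (has_derive_sub (has_derive_idfun x) (has_derive_cst u x))).
  have D2 := has_derive_add (has_derive_cst 1 x) D.
  have nz : 1 + expR (lam * (x - u)) != 0 by rewrite gt_eqF // d0.
  apply: has_derive_eq (has_derive_inv (f := fun y => 1 + expR (lam * (y - u))) nz D2) _.
  by rewrite /h' /h /g; field.
have h'_le x : `|h' x| <= lam.
  rewrite /h' mulNr normrN ger0_norm; last first.
    by apply: mulr_ge0; [apply: mulr_ge0; exact: ltW | exact: sqr_ge0].
  rewrite -mulrA ler_piMr ?(ltW lam0) // expr2 mulrA.
  have gh : g x * h x <= 1 by rewrite ler_pdivrMr //; lra.
  by rewrite mulr_ile1 // ?mulr_ge0 // ltW.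
have h_cont : continuous h by move=> x; apply: has_derive_continuous (dh x).
have [F [F' [L1 [L2 [L10 L20 HL1 HL2 HF]]]]] := stein_solution h01 dh h'_le eta0.
exists F, F', L1, L2; split=> //.
set mean := gauss_int h setT in HF.
have P0 := Phi_ge0 (u - s); have P1 := Phi_le1 (u + s).
have mean_ge : Phi (u - s) - eta <= mean.
  rewrite /mean (gauss_int_split h01 h_cont (u - s)).
  apply: ler_wpDr; first exact: gauss_int_ge0.
  apply: le_trans (_ : gauss_int (cst (1 - eta)) `]-oo, (u - s)] <= _).
    by rewrite gauss_int_cst // -PhiE; have := Phi_le1 (u - s); nra.
  apply: gauss_int_le => //; first exact: cst_continuous.
    by move=> x; rewrite /cst /=; apply/andP; split; lra.
have mean_le : mean <= Phi (u + s) + eta.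
  rewrite /mean (gauss_int_split h01 h_cont (u + s)); apply: lerD.
    by rewrite PhiE; apply: gauss_int_le.
  apply: le_trans (_ : gauss_int (cst eta) `](u + s), +oo[ <= _).
    apply: gauss_int_le => //; first exact: cst_continuous.
      by move=> x; rewrite /cst /=; apply/andP; split; lra.
    by move=> x /=; rewrite in_itv /= andbT => /ltW/hr.
  rewrite gauss_int_cst // -Phi_compl; have := Phi_ge0 (u + s); nra.
move=> x; have := HF x; rewrite ler_norml => /andP[A B].
have up : h x <= (x <= u + s)%R%:R + eta.
  case: (leP x (u + s)) => [_|/ltW/hr]; last by rewrite add0r.
  by apply: le_trans (h1 x) _; rewrite lerDl ltW.
have lo : (x <= u - s)%R%:R - eta <= h x.
  case: (leP x (u - s)) => [/hl //|_]; rewrite add0r.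
  by have := ltW (h0 x); lra.
split; lra.
Qed.

End SteinIndicator.

(** * From Stein bounds to convergence of distribution functions *)

Section SteinLimit.
Variables (R : realType) (T : Type) (F : set_system T).
Hypothesis FF : Filter F.
Variables (N : T -> nat) (p : T -> R) (W : forall a, outcome (N a) -> R) (D : T -> R).
Hypothesis p01 : forall a, 0 <= p a <= 1.
Local Notation v a := (Ex (p a) (fun w => @W a w ^+ 2)).
Hypothesis D_ge0 : forall a, 0 <= D a.
Hypothesis stein : \forall a \near F, forall (f f' : R -> R) (L1 L2 b : R),
  0 < b -> 0 <= L1 -> 0 <= L2 -> (forall x, `|f' x| <= L1) ->
  (forall x y, `|f y - f x - (y - x) * f' y| <= L2 * (y - x) ^+ 2) ->
  `|Ex (p a) (fun w => @W a w * f (@W a w)) - v a * Ex (p a) (fun w => f' (@W a w))| <=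
  (L1 + L2) * (9 * b + 16 * D a / b).
Hypothesis v_cvg : (fun a => v a) @ F --> (1 : R).
Hypothesis D_cvg : D @ F --> (0 : R).

Let v_near d : 0 < d -> \forall a \near F, `|1 - v a| <= d.
Proof. by move: d; apply/cvgrPdist_le. Qed.

Let D_near d : 0 < d -> \forall a \near F, D a <= d.
Proof.
move=> d0; move/cvgrPdist_le : D_cvg => /(_ d d0); apply: filterS => a.
by rewrite sub0r normrN; apply: le_trans; apply: ler_norm.
Qed.

Lemma stein_error (f f' : R -> R) (L1 L2 e : R) : 0 < e -> 0 <= L1 -> 0 <= L2 ->
  (forall x, `|f' x| <= L1) ->
  (forall x y, `|f y - f x - (y - x) * f' y| <= L2 * (y - x) ^+ 2) ->
  \forall a \near F, `|Ex (p a) (fun w => f' (@W a w) - @W a w * f (@W a w))| <= e.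
Proof.
move=> e0 L10 L20 H1 H2; set L := L1 + L2 + 1.
have L0 : 0 < L by rewrite /L ltr_pwDr // addr_ge0.
(* With L bounding L1 + L2, each of the three errors is at most e / 3: [9 * b * L] by this choice,
   the term with [D a / b] once [D a] is small relative to the fixed b, and the variance error |1 -
   v| L1. *)
pose b := e / (27 * L).
have b0 : 0 < b by rewrite divr_gt0 // mulr_gt0.
near=> a.
have st : `|Ex (p a) (fun w => @W a w * f (@W a w)) - v a * Ex (p a) (fun w => f' (@W a w))| <=
    (L1 + L2) * (9 * b + 16 * D a / b).
  by near: a; apply: filterS stein => a st; apply: st.
have va : `|1 - v a| <= e / (3 * L).
  by near: a; apply: v_near; rewrite divr_gt0 // mulr_gt0.
have Da : D a <= b * (e / (48 * L)).
  near: a; apply: D_near; by rewrite mulr_gt0 // divr_gt0 // mulr_gt0.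
have -> : Ex (p a) (fun w => f' (@W a w) - @W a w * f (@W a w)) =
    (1 - v a) * Ex (p a) (fun w => f' (@W a w)) -
    (Ex (p a) (fun w => @W a w * f (@W a w)) - v a * Ex (p a) (fun w => f' (@W a w))).
  by rewrite ExB; ring.
have Ef' : `|Ex (p a) (fun w => f' (@W a w))| <= L1.
  apply: le_trans (normr_Ex (p01 a) _) _; rewrite -[leRHS](Ex_cst (N a) (p a)).
  by apply: (ler_Ex (p01 a)) => w.
apply: le_trans (ler_normB _ _) _; rewrite normrM.
have t1 : `|1 - v a| * `|Ex (p a) (fun w => f' (@W a w))| <= e / 3.
  apply: le_trans (_ : (e / (3 * L)) * L <= _).
    by apply: ler_pM => //; apply: le_trans Ef' _; rewrite /L; lra.
  by rewrite le_eqVlt; apply/orP; left; apply/eqP; field; rewrite gt_eqF.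
have t2 : (L1 + L2) * (9 * b + 16 * D a / b) <= e * (2 / 3).
  apply: le_trans (_ : L * (9 * b + 16 * (b * (e / (48 * L))) / b) <= _).
    apply: ler_pM; first exact: addr_ge0.
    - have := D_ge0 a; have := ltW b0 => b1 Da0.
      by apply: addr_ge0; [apply: mulr_ge0 | apply: divr_ge0; [apply: mulr_ge0|]].
    - by rewrite /L; lra.
    - by rewrite lerD2l ler_pM2r ?invr_gt0 // ler_pM2l.
  rewrite le_eqVlt; apply/orP; left; apply/eqP; rewrite /b; field.
  by rewrite !gt_eqF.
apply: le_trans (lerD t1 (le_trans st t2)) _; lra.
Unshelve. all: by end_near. Qed.

Lemma stein_cvg t : (fun a => Prob (p a) (fun w => @W a w <= t)) @ F --> Phi t.
Proof.
apply/cvgrPdist_le => e e0.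
have K0 : 0 < normal_peak 1 :> R by rewrite normal_peak_gt0 // oner_eq0.
(* [Phi] varies by at most e / 4 over a length 2 s; [eta <= e / 24] makes [eta * (v a + 4)] at most
   e / 4, since v a is at most 2. *)
pose s := e / (8 * normal_peak 1).
have s0 : 0 < s by rewrite divr_gt0 // mulr_gt0.
have PhiL x : `|Phi (x + s + s) - Phi x| <= e / 4.
  apply: le_trans (Phi_lipschitz _ _) _.
  rewrite (_ : x + s + s - x = s * 2); last by ring.
  have s2 : 0 <= s * 2 by lra.
  have -> : e / 4 = normal_peak 1 * (s * 2) by rewrite /s; field; rewrite gt_eqF.
  by rewrite (ger0_norm s2).
pose eta := Order.min (e / 24) (1 / 2).
have eta0 : 0 < eta by rewrite lt_min divr_gt0 //= divr_gt0.
have eta1 : eta < 1 by rewrite gt_min; apply/orP; right; lra.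
have etae : eta <= e / 24 by rewrite ge_min lexx.
have etab : 0 < eta < 1 by rewrite eta0.
(* Centring at t + s puts the indicator of [x <= t] into the lower inequality, which bounds the
   probability from above; centring at t - s does the converse. *)
have [f [f' [L1 [L2 [L10 L20 H1 H2 Hf]]]]] := stein_indicator (t + s) s0 etab.
have [g [g' [M1 [M2 [M10 M20 G1 G2 Hg]]]]] := stein_indicator (t - s) s0 etab.
have e4 : 0 < e / 4 by rewrite divr_gt0.
near=> a.
have va : `|1 - v a| <= 1 by near: a; apply: v_near.
have Ef : `|Ex (p a) (fun w => f' (@W a w) - @W a w * f (@W a w))| <= e / 4.
  by near: a; apply: (stein_error e4 L10 L20 H1 H2).
have Eg : `|Ex (p a) (fun w => g' (@W a w) - @W a w * g (@W a w))| <= e / 4.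
  by near: a; apply: (stein_error e4 M10 M20 G1 G2).
have cst_part (c d : R) : Ex (p a) (fun w => (@W a w <= t)%R%:R - c + d * (@W a w ^+ 2 + 4)) =
    Prob (p a) (fun w => @W a w <= t) - c + d * (v a + 4).
  by rewrite ExD ExB Ex_cst -ProbE ExZ ExD Ex_cst.
have U : Prob (p a) (fun w => @W a w <= t) - Phi (t + s + s) - eta * (v a + 4) <=
    Ex (p a) (fun w => f' (@W a w) - @W a w * f (@W a w)).
  rewrite -mulNr -cst_part; apply: (ler_Ex (p01 a)) => w.
  by have [+ _] := Hf (@W a w); rewrite addrK mulNr.
have V : Ex (p a) (fun w => g' (@W a w) - @W a w * g (@W a w)) <=
    Prob (p a) (fun w => @W a w <= t) - Phi (t - s - s) + eta * (v a + 4).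
  rewrite -cst_part; apply: (ler_Ex (p01 a)) => w.
  by have [_] := Hg (@W a w); rewrite subrK.
have P1 := PhiL t; have P2 := PhiL (t - s - s).
rewrite !subrK in P2.
have v2 : eta * (v a + 4) <= e / 4.
  have v2 : v a <= 2 by move: va; rewrite ler_norml => /andP[]; lra.
  have v0 : 0 <= v a by apply: (Ex_ge0 (p01 a)) => w; apply: sqr_ge0.
  apply: le_trans (_ : (e / 24) * 6 <= _); last by lra.
  by apply: ler_pM; rewrite ?(ltW eta0) ?addr_ge0 //; lra.
move: Ef Eg P1 P2; rewrite !ler_norml => /andP[? ?] /andP[? ?] /andP[? ?] /andP[? ?].
apply/andP; split; lra.
Unshelve. all: by end_near. Qed.

End SteinLimit.

(** * Truncated Gaussian moments *)

Section GaussianMoments.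
Variable R : realType.
Local Notation Phi := (@Phi R).
Local Notation phi := (@normal_pdf R 0 1).
Implicit Types (x y K : R).

(** [gauss2], [gauss4] and [gauss5] are primitives of x^n phi(x), found by repeated integration by
    parts; their increments are truncated Gaussian moments. *)
Definition gauss2 x := Phi x - x * phi x.
Definition gauss4 x := 3 * Phi x - (x ^+ 3 + 3 * x) * phi x.
Definition gauss5 x := - ((x ^+ 4 + 4 * x ^+ 2 + 8) * phi x).

Let derive_pow n x : is_derive x 1 (fun y => y ^+ n) (n%:R * x ^+ n.-1).
Proof.
elim: n => [|n IHn].
  by rewrite mul0r; apply: has_derive_cst.
have -> : (fun y => y ^+ n.+1) = (fun y => y * y ^+ n) by apply/funext => y; rewrite exprS.
apply: has_derive_eq (has_derive_mul (has_derive_idfun x) IHn) _.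
case: n {IHn} => [|n]; first by rewrite /= !mul0r mulr0 addr0.
by rewrite /= -[n.+2%:R]natr1 exprS; ring.
Qed.

Lemma derive_gauss2 x : is_derive x 1 gauss2 (x ^+ 2 * phi x).
Proof.
have D := has_derive_mul (has_derive_idfun x) (has_derive_phi x).
apply: has_derive_eq (has_derive_sub (has_derive_Phi x) D) _; ring.
Qed.

Lemma derive_gauss4 x : is_derive x 1 gauss4 (x ^+ 4 * phi x).
Proof.
have D3 := has_derive_mul (has_derive_cst 3 x) (has_derive_idfun x).
have D := has_derive_mul (has_derive_add (derive_pow 3 x) D3) (has_derive_phi x).
have DP := has_derive_mul (has_derive_cst 3 x) (has_derive_Phi x).
apply: has_derive_eq (has_derive_sub DP D) _; rewrite /=; ring.
Qed.

Lemma derive_gauss5 x : is_derive x 1 gauss5 (x ^+ 5 * phi x).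
Proof.
have D2 := has_derive_mul (has_derive_cst 4 x) (derive_pow 2 x).
have D := has_derive_add (has_derive_add (derive_pow 4 x) D2) (has_derive_cst 8 x).
apply: has_derive_eq (has_derive_opp (has_derive_mul D (has_derive_phi x))) _; rewrite /=; ring.
Qed.

Lemma peak_le1 : normal_peak 1 <= 1 :> R.
Proof.
rewrite /normal_peak expr1n mul1r.
have s1 : 1 <= Num.sqrt (pi *+ 2 : R).
  by rewrite -[leLHS]sqrtr1 ler_wsqrtr // mulr2n; have := @pi_ge2 R; lra.
by rewrite invf_le1 //; apply: lt_le_trans s1.
Qed.

Lemma phi_le1 x : phi x <= 1.
Proof. by apply: le_trans peak_le1; rewrite normal_pdf_ub // oner_eq0. Qed.

Lemma phi_even x : phi (- x) = phi x.
Proof. by rewrite !phiE sqrrN. Qed.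

(** With y = x^2 / 8 the exponential is the fourth power of exp(-y), and y exp(-y) <= 1; the
    constant comes from x^8 = 8^4 y^4. *)
Lemma phi_decay x : x ^+ 8 * phi x <= 8 ^+ 4.
Proof.
set y := x ^+ 2 / 8; have y0 : 0 <= y by rewrite divr_ge0 ?sqr_ge0.
have e4 : y ^+ 4 * expR (- (x ^+ 2 / 2)) <= 1.
  rewrite (_ : - (x ^+ 2 / 2) = 4%:R * - y); last by rewrite /y; field.
  rewrite expRM_natl -exprMn.
  have e : y * expR (- y) <= 1.
    rewrite expRN ler_pdivrMr ?expR_gt0 // mul1r; apply: le_trans (expR_ge1Dx y).
    by rewrite lerDr.
  by rewrite exprn_ile1 // mulr_ge0 ?expR_ge0.
have -> : x ^+ 8 * phi x = 8 ^+ 4 * (normal_peak 1 * (y ^+ 4 * expR (- (x ^+ 2 / 2)))).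
  have -> : x ^+ 8 = 8 ^+ 4 * y ^+ 4.
    by rewrite -exprMn /y mulrC divfK ?pnatr_eq0 // -exprM.
  by rewrite phiE; move: (8 ^+ 4) (y ^+ 4) => b z; ring.
rewrite ler_piMr ?exprn_ge0 // mulr_ile1 ?normal_peak_ge0 ?peak_le1 //.
by rewrite mulr_ge0 ?expR_ge0 ?exprn_ge0.
Qed.

Lemma phi_decay3 K : 1 <= K -> K ^+ 3 * phi K <= 8 ^+ 4 / K.
Proof.
move=> K1; have K0 : 0 < K by lra.
rewrite ler_pdivlMr // mulrAC -exprSr; apply: le_trans (phi_decay K).
by rewrite ler_wpM2r ?(ltW (phi_gt0 _)) // ler_weXn2l.
Qed.

Lemma Phi_tail K : 1 <= K -> Phi (- K) <= phi K /\ 1 - Phi K <= phi K.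
Proof.
move=> K1; have K0 : 0 < K by lra.
have := @mills_neg R (- K); rewrite oppr_lt0 => /(_ K0); rewrite opprK phi_even => a.
have b := mills_pos K0; have := Phi_ge0 (- K); have := Phi_le1 K.
by split; nra.
Qed.

Lemma gauss2_lim K : 1 <= K -> `|gauss2 K - gauss2 (- K) - 1| <= 20 * 8 ^+ 4 / K.
Proof.
move=> K1; have [a b] := Phi_tail K1; have := phi_decay3 K1; rewrite -mulrA.
have k3 : 1 <= K ^+ 3 by rewrite exprn_ege1.
have k3' : K <= K ^+ 3 by rewrite -[leLHS]expr1 ler_weXn2l.
have p0 := ltW (phi_gt0 K).
have e0 : 0 <= K * phi K by rewrite mulr_ge0 //; lra.
have e1 := ler_wpM2r p0 k3; have e2 := ler_wpM2r p0 k3'.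
rewrite /gauss2 phi_even ler_norml; have := Phi_ge0 (- K); have := Phi_le1 K.
move: (8 ^+ 4 / K) => q; rewrite mul1r in e1.
by move=> *; apply/andP; split; lra.
Qed.

Lemma gauss4_lim K : 1 <= K -> `|gauss4 K - gauss4 (- K) - 3| <= 20 * 8 ^+ 4 / K.
Proof.
move=> K1; have [a b] := Phi_tail K1; have := phi_decay3 K1; rewrite -mulrA.
have k3 : 1 <= K ^+ 3 by rewrite exprn_ege1.
have k3' : K <= K ^+ 3 by rewrite -[leLHS]expr1 ler_weXn2l.
have p0 := ltW (phi_gt0 K).
have e0 : 0 <= K * phi K by rewrite mulr_ge0 //; lra.
have e1 := ler_wpM2r p0 k3; have e2 := ler_wpM2r p0 k3'.
have n3 : (- K) ^+ 3 = - K ^+ 3 by ring.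
rewrite /gauss4 n3.
rewrite /gauss4 phi_even ler_norml; have := Phi_ge0 (- K); have := Phi_le1 K.
move: (8 ^+ 4 / K) => q; rewrite mul1r in e1.
by move=> *; apply/andP; split; lra.
Qed.

Lemma exp_lipschitz n K : 0 <= K -> exists2 L, 0 <= L & forall x y, `|x| <= K -> `|y| <= K ->
  `|x ^+ n - y ^+ n| <= L * `|x - y|.
Proof.
move=> K0; elim: n => [|n [L L0 IHn]].
  by exists 0 => // x y _ _; rewrite !expr0 subrr normr0 mul0r.
exists (K * L + K ^+ n) => [|x y xK yK]; first by rewrite addr_ge0 ?mulr_ge0 ?exprn_ge0.
rewrite (_ : _ - _ = x * (x ^+ n - y ^+ n) + y ^+ n * (x - y)); last by rewrite !exprS; ring.
apply: le_trans (ler_normD _ _) _; rewrite mulrDl !normrM normrX lerD //.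
  by rewrite -mulrA ler_pM ?IHn.
by rewrite ler_wpM2r // lerXn2r ?nnegrE.
Qed.

End GaussianMoments.

(** * Convergence of moments from convergence of distribution functions *)

Section TruncatedMoments.
Variables (R : realType) (T : Type) (F : set_system T).
Hypothesis FF : Filter F.
Variables (N : T -> nat) (p : T -> R) (W : forall a, outcome (N a) -> R).
Arguments W : clear implicits.
Hypothesis p01 : forall a, 0 <= p a <= 1.
Local Notation Phi := (@Phi R).
Local Notation phi := (@normal_pdf R 0 1).
Implicit Types (x y K : R).

Let P a x := Prob (p a) (fun w => W a w <= x).

Hypothesis cdf_cvg : forall t, (fun a => Prob (p a) (fun w => W a w <= t)) @ F --> Phi t.

(** The indicator of a half-open interval as a difference of two indicators: its expectation is an
    increment of the distribution function, and consecutive slices telescope. *)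
Definition slice a x y (w : outcome (N a)) : R := (W a w <= y)%R%:R - (W a w <= x)%R%:R.

Lemma sliceE a x y w : x <= y -> slice x y w = ((x < W a w) && (W a w <= y))%R%:R.
Proof.
move=> xy; rewrite /slice; case: (leP (W a w) x) => [wx|] /=; last by rewrite subr0.
by rewrite (le_trans wx xy) subrr.
Qed.

Lemma Ex_slice a x y : Ex (p a) (@slice a x y) = P a y - P a x.
Proof. by rewrite ExB -!ProbE. Qed.

Section Lipschitz.
Variables (g G : R -> R) (A B L : R).
Hypothesis AB : A < B.
Hypothesis L_ge0 : 0 <= L.
Hypothesis g_lip : forall x y, A <= x <= B -> A <= y <= B -> `|g x - g y| <= L * `|x - y|.
Hypothesis derive_G : forall x : R, is_derive x 1 G (g x * phi x).

Let slice_step a x y : A <= x -> x <= y -> y <= B ->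
  `|Ex (p a) (fun w => g (W a w) * slice x y w) - g x * (P a y - P a x)| <=
  L * (y - x) * (P a y - P a x).
Proof.
move=> Ax xy yB; rewrite -Ex_slice -!ExZ -ExB.
apply: le_trans (normr_Ex (p01 a) _) _; apply: (ler_Ex (p01 a)) => w.
rewrite -mulrBl normrM sliceE // normr_nat.
have [/andP[xw wy]|_] := boolP (_ && _); last by rewrite !mulr0.
rewrite !mulr1; apply: le_trans (g_lip _ _) _.
- by rewrite (le_trans Ax (ltW xw)) (le_trans wy).
- by rewrite Ax (le_trans xy).
- by rewrite ler_wpM2l // ger0_norm ?subr_ge0 ?(ltW xw) // lerD2r.
Qed.

(** The counterpart of [slice_step] for the normal law. Both sides of the absolute value follow from
    the monotonicity of c (G - g(x) Phi) + L (y - x) Phi with c = 1 and c = -1. *)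
Let gauss_step x y : A <= x -> x <= y -> y <= B ->
  `|(G y - G x) - g x * (Phi y - Phi x)| <= L * (y - x) * (Phi y - Phi x).
Proof.
move=> Ax xy yB.
have near_x z : x <= z <= y -> `|g z - g x| <= L * (y - x).
  move=> /andP[xz zy]; apply: le_trans (g_lip _ _) _.
  - by rewrite (le_trans Ax xz) (le_trans zy).
  - by rewrite Ax (le_trans xy).
  - by rewrite ler_wpM2l // ger0_norm ?subr_ge0 // lerD2r.
have mono (c : R) : (forall z, x <= z <= y -> 0 <= c * (g z - g x) + L * (y - x)) ->
   0 <= c * ((G y - G x) - g x * (Phi y - Phi x)) + L * (y - x) * (Phi y - Phi x).
  move=> H.
  have D z : x <= z <= y -> is_derive z 1 (fun z => c * (G z - g x * Phi z) + L * (y - x) * Phi z)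
      ((c * (g z - g x) + L * (y - x)) * phi z).
    move=> _; have D1 := has_derive_mul (has_derive_cst (g x) z) (has_derive_Phi z).
    have D2 := has_derive_mul (has_derive_cst c z) (has_derive_sub (derive_G z) D1).
    have D3 := has_derive_mul (has_derive_cst (L * (y - x)) z) (has_derive_Phi z).
    by apply: has_derive_eq (has_derive_add D2 D3) _; ring.
  suff : c * (G x - g x * Phi x) + L * (y - x) * Phi x <=
         c * (G y - g x * Phi y) + L * (y - x) * Phi y by lra.
  by apply: (derive_nondecreasing xy D) => z xzy; rewrite mulr_ge0 ?H // ltW // phi_gt0.
have up := mono 1; have lo := mono (-1).
rewrite ler_norml; apply/andP; split.
  suff : 0 <= 1 * ((G y - G x) - g x * (Phi y - Phi x)) + L * (y - x) * (Phi y - Phi x) by lra.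
  by apply: up => z /near_x; rewrite ler_norml => /andP[]; lra.
suff : 0 <= -1 * ((G y - G x) - g x * (Phi y - Phi x)) + L * (y - x) * (Phi y - Phi x) by lra.
by apply: lo => z /near_x; rewrite ler_norml => /andP[]; lra.
Qed.

(** Both expectations are within e / 3 of Riemann sums on a fixed mesh, uniformly in the index;
    these finite sums converge because the distribution functions do at each mesh point. *)
Lemma truncated_cvg :
  (fun a => Ex (p a) (fun w => g (W a w) * slice A B w)) @ F --> G B - G A.
Proof.
apply/cvgrPdist_le => e e0.
have BA : 0 < B - A by rewrite subr_gt0.
pose n := (Num.truncn (3 * L * (B - A) / e)).+1.
have n0 : 0 < n%:R :> R by rewrite ltr0n.
pose d := (B - A) / n%:R.
have d0 : 0 < d by rewrite divr_gt0.
have Ld : L * d <= e / 3.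
  have : 3 * L * (B - A) / e < n%:R by apply: truncnS_gt.
  rewrite ltr_pdivrMr // => H; rewrite /d mulrA ler_pdivrMr //; lra.
pose x (j : nat) := A + j%:R * d.
have x0 : x 0%N = A by rewrite /x mul0r addr0.
have xn : x n = B by rewrite /x /d mulrC divfK ?gt_eqF // addrC subrK.
have xS j : x j.+1 - x j = d by rewrite /x -natr1; ring.
have xj j : x j <= x j.+1 by rewrite -subr_ge0 xS ltW.
have xA j : A <= x j by rewrite /x lerDl mulr_ge0 // ltW.
have xB j : (j < n)%N -> x j.+1 <= B.
  by move=> jn; rewrite -xn /x lerD2l ler_pM2r // ler_nat.
have tel (f : R -> R) : f B - f A = \sum_(0 <= j < n) (f (x j.+1) - f (x j)).
  by rewrite (telescope_sumr (fun j => f (x j))) // xn x0.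
pose SP a := \sum_(0 <= j < n) g (x j) * (P a (x j.+1) - P a (x j)).
pose SG := \sum_(0 <= j < n) g (x j) * (Phi (x j.+1) - Phi (x j)).
have SP_cvg : SP @ F --> SG.
  rewrite /SP /SG; elim: (index_iota 0 n) => [|j r IH].
    by under eq_fun do rewrite big_nil; rewrite big_nil; apply: cvg_cst.
  under eq_fun do rewrite big_cons.
  rewrite big_cons; apply: cvgD IH; apply: cvgMl_tmp.
  by apply: cvgB; apply: cdf_cvg.
have SGb : `|G B - G A - SG| <= e / 3.
  rewrite tel -sumrB; apply: le_trans (ler_norm_sum _ _ _) _.
  apply: le_trans (_ : \sum_(0 <= j < n) L * d * (Phi (x j.+1) - Phi (x j)) <= _).
    rewrite !big_nat; apply: ler_sum => j /andP[_ jn].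
    by rewrite -(xS j) gauss_step ?xA ?xj ?xB.
  rewrite -mulr_sumr -tel; apply: le_trans Ld.
  by rewrite ler_piMr ?mulr_ge0 ?(ltW d0) //; have := Phi_le1 B; have := Phi_ge0 A; lra.
have SPb a : `|Ex (p a) (fun w => g (W a w) * slice A B w) - SP a| <= e / 3.
  have -> : Ex (p a) (fun w => g (W a w) * slice A B w) =
      \sum_(0 <= j < n) Ex (p a) (fun w => g (W a w) * slice (x j) (x j.+1) w).
    rewrite big_mkord -Ex_sum; apply: eq_Ex => w; rewrite -mulr_sumr; congr (_ * _).
    by rewrite /slice (tel (fun t => (W a w <= t)%R%:R)) big_mkord.
  rewrite -sumrB; apply: le_trans (ler_norm_sum _ _ _) _.
  apply: le_trans (_ : \sum_(0 <= j < n) L * d * (P a (x j.+1) - P a (x j)) <= _).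
    rewrite !big_nat; apply: ler_sum => j /andP[_ jn].
    by rewrite -(xS j) slice_step ?xA ?xj ?xB.
  have PAB : P a B - P a A <= 1.
    rewrite -Ex_slice -[leRHS](Ex_cst (N a) (p a)).
    by apply: (ler_Ex (p01 a)) => w; rewrite sliceE ?(ltW AB) // lern1 leq_b1.
  rewrite -mulr_sumr -(tel (P a)); apply: le_trans Ld.
  by apply: ler_piMr PAB; apply: mulr_ge0 => //; exact: ltW.
near=> a.
have SPG : `|SG - SP a| <= e / 3.
  by near: a; move/cvgrPdist_le : SP_cvg; apply; rewrite divr_gt0.
have := SPb a; rewrite distrC => SPb'.
rewrite (_ : _ - _ = (G B - G A - SG) + (SG - SP a) +
  (SP a - Ex (p a) (fun w => g (W a w) * slice A B w))); last by ring.
apply: le_trans (ler_normD _ _) _; apply: le_trans (lerD (ler_normD _ _) (lexx _)) _; lra.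
Unshelve. all: by end_near. Qed.

End Lipschitz.

Lemma truncated_power_cvg n (G : R -> R) A B : A < B ->
  (forall x : R, is_derive x 1 G (x ^+ n * phi x)) ->
  (fun a => Ex (p a) (fun w => W a w ^+ n * slice A B w)) @ F --> G B - G A.
Proof.
move=> AB dG; have K0 : 0 <= Order.max `|A| `|B| by rewrite le_max normr_ge0.
have [L L0 HL] := exp_lipschitz n K0.
apply: (truncated_cvg (g := fun x => x ^+ n) AB L0) => // x y.
have bd z : A <= z <= B -> `|z| <= Order.max `|A| `|B|.
  move=> /andP[Az zB]; rewrite le_max; have [z0|z0] := lerP 0 z.
    by rewrite (ger0_norm z0) (le_trans zB (ler_norm _)) orbT.
  have A0 := le_lt_trans Az z0.
  by rewrite (ltr0_norm z0) (ltr0_norm A0) lerN2 Az.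
by move=> /bd xK /bd yK; apply: HL.
Qed.

(** For n <= 4 and |W| >= K >= 1 one has |W|^n <= |W|^5 / K, so a fifth-moment bound makes the tails
    uniformly small. *)
Lemma moment_cvg n (G : R -> R) (l C C' : R) : (0 < n < 5)%N -> ~~ odd n ->
  (forall x : R, is_derive x 1 G (x ^+ n * phi x)) ->
  (forall K, 1 <= K -> `|G K - G (- K) - l| <= C' / K) ->
  (\forall a \near F, Ex (p a) (fun w => `|W a w| ^+ 5) <= C) ->
  (fun a => Ex (p a) (fun w => W a w ^+ n)) @ F --> l.
Proof.
move=> /andP[n0 n5] on dG Gl HC; apply/cvgrPdist_le => e e0.
(* Chosen so that C / K and C' / K are both at most e / 3. *)
pose K := 1 + 3 * (`|C| + `|C'|) / e.
have K1 : 1 <= K by rewrite lerDl divr_ge0 ?mulr_ge0 ?addr_ge0 // ltW.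
have K0 : 0 < K by apply: lt_le_trans K1.
have Ke c : `|c| <= `|C| + `|C'| -> c / K <= e / 3.
  move=> cC; rewrite ler_pdivrMr // /K mulrDr.
  rewrite (_ : e / 3 * (3 * (`|C| + `|C'|) / e) = `|C| + `|C'|); last by field; rewrite gt_eqF.
  by have := ler_norm c; lra.
have NK : - K < K by lra.
have TC := truncated_power_cvg NK dG.
near=> a.
have t1 : `|G K - G (- K) - Ex (p a) (fun w => W a w ^+ n * slice (- K) K w)| <= e / 3.
  by near: a; move/cvgrPdist_le : TC; apply; rewrite divr_gt0.
have t2 : Ex (p a) (fun w => `|W a w| ^+ 5) <= C by near: a.
have t3 : `|Ex (p a) (fun w => W a w ^+ n) - Ex (p a) (fun w => W a w ^+ n * slice (- K) K w)|
    <= C / K.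
  rewrite -ExB; apply: le_trans (normr_Ex (p01 a) _) _.
  apply: le_trans (_ : Ex (p a) (fun w => `|W a w| ^+ 5 / K) <= _); last first.
    by rewrite ExZr ler_pM2r // invr_gt0.
  apply: (ler_Ex (p01 a)) => w; rewrite sliceE ?(ltW NK) //.
  have [_|wK] := boolP (_ && _).
    by rewrite mulr1 subrr normr0 divr_ge0 ?exprn_ge0 // ltW.
  rewrite mulr0 subr0 normrX ler_pdivlMr //.
  have KW : K <= `|W a w|.
    move: wK; rewrite negb_and -leNgt -ltNge => /orP[h|h].
      by apply: le_trans (_ : - W a w <= _); [lra | rewrite -normrN ler_norm].
    by apply: le_trans (ltW h) (ler_norm _).
  apply: le_trans (_ : `|W a w| ^+ n.+1 <= _).
    by rewrite exprSr ler_wpM2l ?exprn_ge0.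
  by rewrite ler_weXn2l // (le_trans K1).
have b1 := Gl K K1.
have b2 := Ke C' ltac:(by rewrite lerDr).
have b3 := Ke C ltac:(by rewrite lerDl).
rewrite distrC.
rewrite (_ : _ - l = (Ex (p a) (fun w => W a w ^+ n) -
    Ex (p a) (fun w => W a w ^+ n * slice (- K) K w)) -
  (G K - G (- K) - Ex (p a) (fun w => W a w ^+ n * slice (- K) K w)) +
  (G K - G (- K) - l)); last by ring.
apply: le_trans (ler_normD _ _) _; apply: le_trans (lerD (ler_normB _ _) (lexx _)) _; lra.
Unshelve. all: by end_near. Qed.

End TruncatedMoments.

(** * Iterated limits as one filter *)

Section IteratedFilter.
Variable R : realType.

(* The filter of [M -> +oo] after [n -> oo]: the iterated upper limits of the theorem
   vanish exactly when the quantities converge to [0] along it. *)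
Definition iterated_filter : set_system (R * nat) :=
  [set A | \forall M \near (+oo : set_system R), \forall n \near \oo, A (M, n)].

#[global] Instance iterated_filter_filter : Filter iterated_filter.
Proof.
split.
- by apply: (@filterE _ (+oo : set_system R)) => M; apply: (@filterE _ \oo) => n.
- move=> A B; rewrite /iterated_filter /=; apply: filterS2 => M FA FB.
  exact: filterI FA FB.
- move=> A B AB; rewrite /iterated_filter /=; apply: filterS => M.
  by apply: filterS => n; apply: AB.
Qed.

Lemma iterated_filter_snd (A : set nat) :
  iterated_filter (fun a => A a.2) <-> \forall n \near \oo, A n.
Proof.
rewrite /iterated_filter /=; split=> [/filter_ex[M] //|H].
by apply: (@filterE _ (+oo : set_system R)).
Qed.

Lemma iterated_filter_fst (A : set R) :
  (\forall M \near (+oo : set_system R), A M) -> iterated_filter (fun a => A a.1).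
Proof. by rewrite /iterated_filter /=; apply: filterS => M AM; apply: filterE. Qed.

Lemma limf_esup_eq0 (U : choiceType) (X : filteredType U) (F : set_system X)
    (u : X -> \bar R) : ProperFilter F -> (forall x, (0 <= u x)%E) ->
  limf_esup u F = 0%E <-> forall e : R, 0 < e -> \forall x \near F, (u x <= e%:E)%E.
Proof.
move=> FF u0; split=> [u_eq0 e e0|H].
  have : (limf_esup u F < e%:E)%E by rewrite u_eq0 lte_fin.
  move=> /ereal_inf_lt[_ [V FV <-]] lt; apply: filterS FV => x Vx.
  by apply: le_trans (ltW lt); apply: ereal_sup_ubound; exists x.
apply/eqP; rewrite eq_le; apply/andP; split; last first.
  by apply: limf_esup_ge0 => //; apply: filter_not_empty.
apply/lee_addgt0Pr => e e0; rewrite add0e.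
apply: le_trans (_ : ereal_sup [set u x | x in [set x | (u x <= e%:E)%E]] <= _)%E.
  by apply: ereal_inf_lbound; exists [set x | (u x <= e%:E)%E]; first exact: H.
by apply: ge_ereal_sup => _ [x ux <-].
Qed.

Lemma iterated_limsup_eq0 (f : R -> nat -> R) :
  limf_esup (fun M => limn_esup (fun n => (`|f M n|)%:E)) (@pinfty_nbhs R) = 0%E <->
  (fun a => f a.1 a.2) @ iterated_filter --> (0 : R).
Proof.
have ge0 M n : (0 <= (`|f M n|)%:E)%E by rewrite lee_fin.
have ge0' M : (0 <= limn_esup (fun n => (`|f M n|)%:E))%E.
  by apply: limf_esup_ge0 => //; apply: filter_not_empty.
rewrite (@limf_esup_eq0 _ _ (@pinfty_nbhs R)) //; split=> [H|/cvgrPdist_le H e e0].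
  (* Half of e leaves the strict inequality that is needed to extract a set from the infimum
     defining the inner upper limit. *)
  apply/cvgrPdist_le => e e0; have := H _ (divr_gt0 e0 (ltr0n R 2)).
  apply: filterS => M ; rewrite /limn_esup => Me.
  have : (limf_esup (fun n => (`|f M n|)%:E) \oo < e%:E)%E.
    by apply: le_lt_trans Me _; rewrite lte_fin; lra.
  move=> /ereal_inf_lt[_ [V FV <-]] lt; apply: filterS FV => n Vn.
  rewrite sub0r normrN -lee_fin; apply: le_trans (ltW lt).
  by apply: ereal_sup_ubound; exists n.
have : \forall M \near (+oo : set_system R), \forall n \near \oo, `|0 - f M n| <= e := H e e0.
apply: filterS => M Me.
pose V : set nat := [set n | `|f M n| <= e].
apply: le_trans (_ : ereal_sup ((fun n => (`|f M n|)%:E) @` V) <= _)%E.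
  apply: ereal_inf_lbound; exists V => //.
  by apply: filterS Me => n; rewrite sub0r normrN.
by apply: ge_ereal_sup => _ [n ux <-]; rewrite lee_fin.
Qed.

End IteratedFilter.

(** * A fifth-moment bound uniform in the truncation level *)

Section FifthMoment.
Variables (R : realType) (N : nat -> nat) (p : nat -> R).
Variables (Z Y : forall n, outcome (N n) -> R) (K : R).
Arguments Z : clear implicits.
Arguments Y : clear implicits.
Hypothesis p01 : forall n, 0 <= p n <= 1.
Hypothesis cdf_cvg : forall t, (fun n => Prob (p n) (fun w => Z n w <= t)) @ \oo --> Phi t.
Hypothesis Y_le : forall n w, Y n w <= Z n w + 1.
Hypothesis moment5_Y : forall n, 0 <= Ex (p n) (fun w => Y n w ^+ 5).
Hypothesis moment6_Y : forall n, Ex (p n) (fun w => Y n w ^+ 6) <= K.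

(** Convexity of the fifth power; sixteen times [u ^+ 5 + 1] minus the left side is five times the
    polynomial shown, which has the factor (u - 1)^2. *)
Let pos5_le (u : R) : 0 <= u -> (u + 1) ^+ 5 <= 16 * (u ^+ 5 + 1).
Proof.
move=> u0; have : 0 <= (u - 1) ^+ 2 * (3 * u ^+ 3 + 5 * u ^+ 2 + 5 * u + 3).
  by rewrite mulr_ge0 ?sqr_ge0 // !addr_ge0 ?mulr_ge0 ?exprn_ge0.
rewrite (_ : _ * _ = 3 * u ^+ 5 - u ^+ 4 - 2 * u ^+ 3 - 2 * u ^+ 2 - u + 3); last by ring.
rewrite (_ : (u + 1) ^+ 5 = u ^+ 5 + 5 * u ^+ 4 + 10 * u ^+ 3 + 10 * u ^+ 2 + 5 * u + 1);
  last by ring.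
lra.
Qed.

(** |y|^5 is twice the fifth power of the positive part minus y^5, so only y >= 0 needs work. For z
    <= k the bound y <= z + 1 is used, for z > k and y <= k the bound k^5, and for y > k the sixth
    power. *)
Let pointwise (y z k : R) : 1 <= k -> y <= z + 1 ->
  `|y| ^+ 5 <= 2 * (16 * (z ^+ 5 * ((z <= k)%R%:R - (z <= 0)%R%:R) + 1) +
    k ^+ 5 * (1 - (z <= k)%R%:R) + y ^+ 6 / k) - y ^+ 5.
Proof.
move=> k1 yz; have k0 : 0 < k by lra.
have y6 : 0 <= y ^+ 6 / k by rewrite divr_ge0 ?(ltW k0) // exprn_even_ge0.
have k5 : 0 <= k ^+ 5 by rewrite exprn_ge0 // ltW.
have B0 : 0 <= z ^+ 5 * ((z <= k)%R%:R - (z <= 0)%R%:R).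
  case: (leP z 0) => [z0|z0]; first by rewrite (le_trans z0 (ltW k0)) subrr mulr0.
  by rewrite subr0 mulr_ge0 // exprn_ge0 // ltW.
have [y0|y0] := lerP 0 y; last first.
  rewrite (ltr0_norm y0) (_ : (- y) ^+ 5 = - y ^+ 5); last by ring.
  by move: B0; case: (leP z k) => _ B0; rewrite ?subrr ?subr0; lra.
rewrite (ger0_norm y0); suff : y ^+ 5 <= 16 * (z ^+ 5 * ((z <= k)%R%:R - (z <= 0)%R%:R) + 1) +
    k ^+ 5 * (1 - (z <= k)%R%:R) + y ^+ 6 / k by lra.
case: (leP z k) B0 => [zk|kz] B0.
  rewrite subrr mulr0 addr0; apply: ler_wpDr => //.
  case: (leP z 0) B0 => [z0|z0] B0.
    by rewrite subrr mulr0 add0r; apply: le_trans (_ : 1 <= _); [apply: exprn_ile1; lra | lra].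
  rewrite subr0 mulr1; apply: le_trans (pos5_le (ltW z0)).
  by rewrite lerXn2r ?nnegrE //; lra.
rewrite subr0 mulr1; have [yk|ky] := lerP y k.
  have : y ^+ 5 <= k ^+ 5 by rewrite lerXn2r ?nnegrE // ltW.
  lra.
have : y ^+ 5 <= y ^+ 6 / k.
  by rewrite ler_pdivlMr // [leRHS]exprSr ler_wpM2l ?exprn_ge0 // ltW.
lra.
Qed.

Lemma fifth_moment_le : \forall n \near \oo,
  Ex (p n) (fun w => `|Y n w| ^+ 5) <= 2 * (16 * 10 + (8 ^+ 4 + 1) + 1).
Proof.
(* This level reduces the sixth-moment contribution to at most 1 for any K. The price k^5 P(Z > k)
   tends to k^5 (1 - Phi k), which is at most 8^4 for every k, so K leaves the final bound. *)
pose k : R := `|K| + 1.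
have k1 : 1 <= k by rewrite lerDr.
have k0 : 0 < k by apply: lt_le_trans k1.
have T5 : (fun n => Ex (p n) (fun w => Z n w ^+ 5 * slice Z 0 k w)) @ \oo -->
    gauss5 k - gauss5 0.
  exact: (@truncated_power_cvg R nat \oo _ N p Z p01 cdf_cvg 5 (@gauss5 R) 0 k k0
    (@derive_gauss5 R)).
(* The value at 0 is -8 phi(0). Convergence raises 8 to 9 eventually, and 9 + 1 is the 10 of the
   statement. *)
have g5 : gauss5 k - gauss5 0 <= 8 :> R.
  rewrite /gauss5 !expr0n /= mulr0 !add0r.
  have := phi_le1 (0 : R); have := phi_gt0 (0 : R); have := phi_gt0 k.
  have : 0 <= k ^+ 4 by rewrite exprn_ge0 // ltW.
  have := sqr_ge0 k; nra.
have tail : k ^+ 5 * (1 - Phi k) <= 8 ^+ 4.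
  have [_ t] := Phi_tail k1; apply: le_trans (phi_decay k).
  apply: le_trans (ler_wpM2l _ t) _; first by rewrite exprn_ge0 // ltW.
  by rewrite ler_wpM2r ?(ltW (phi_gt0 _)) // ler_weXn2l.
have tail_cvg : (fun n => k ^+ 5 * (1 - Prob (p n) (fun w => Z n w <= k))) @ \oo -->
    k ^+ 5 * (1 - Phi k).
  by apply: cvgMl_tmp; apply: cvgB; [apply: cvg_cst | apply: cdf_cvg].
near=> n.
have c1 : Ex (p n) (fun w => Z n w ^+ 5 * slice Z 0 k w) <= 9.
  by near: n; apply: (cvgr_le _ T5); lra.
have c2 : k ^+ 5 * (1 - Prob (p n) (fun w => Z n w <= k)) <= 8 ^+ 4 + 1.
  by near: n; apply: (cvgr_le _ tail_cvg); lra.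
have c3 : Ex (p n) (fun w => Y n w ^+ 6) / k <= 1.
  rewrite ler_pdivrMr // mul1r; apply: le_trans (moment6_Y n) _.
  by rewrite /k; have := ler_norm K; lra.
apply: le_trans (_ : Ex (p n) (fun w => 2 * (16 * (Z n w ^+ 5 * slice Z 0 k w + 1) +
    k ^+ 5 * (1 - (Z n w <= k)%R%:R) + Y n w ^+ 6 / k) - Y n w ^+ 5) <= _).
  by apply: (ler_Ex (p01 n)) => w; apply: pointwise.
rewrite ExB ExZ !ExD ExZ ExD Ex_cst ExZ ExB Ex_cst -ProbE ExZr.
have := moment5_Y n; move: c1 c2 c3.
set A := Ex _ _; set B := _ * (1 - _); set C := _ / k; set D := Ex _ _.
by move: (8 ^+ 4) => c; lra.
Unshelve. all: by end_near. Qed.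

End FifthMoment.

(** * The limit theorem for a sequence of graphs *)

Section GraphSequence.
Variables (R : realType) (N : nat -> nat) (G : forall n : nat, rel 'I_(N n)).
Variables (k : nat) (eH : rel 'I_k) (p : nat -> R).
Hypothesis p_small : forall n, 0 < p n <= 1 / 20.
Hypothesis var_gt0 : forall n, 0 < VarT (@G n) eH (p n).

Let p01 n : 0 <= p n <= 1.
Proof. by case/andP: (p_small n) => ??; apply/andP; split; lra. Qed.

Local Notation IE := (@iterated_filter R).
Let c n := @image_set (N n) k.
Let m n := copy_weight (@G n) eH (p n).
Arguments c : clear implicits.
Arguments m : clear implicits.
Let Z n (w : outcome (N n)) : R := csum (p n) (c n) (m n) w.
Let mu (a : R * nat) := light_weight (p a.2) (c a.2) (m a.2) a.1.
Arguments mu : clear implicits.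
Let Y (a : R * nat) (w : outcome (N a.2)) : R := csum (p a.2) (c a.2) (mu a) w.
Let sh (a : R * nat) := centering_shift (p a.2) (c a.2) (m a.2) a.1.
Let C : R := 2 ^+ k * 2.

Arguments Z : clear implicits.
Arguments Y : clear implicits.

Let C_gt0 : 0 < C. Proof. by rewrite mulr_gt0 // exprn_gt0. Qed.

Let m_ge0 n s : 0 <= m n s. Proof. exact: copy_weight_ge0. Qed.
Let card_c n s : (#|c n s| <= k)%N. Proof. exact: card_image_set. Qed.
Let var1 n : csum_var (p n) (c n) (m n) = 1. Proof. exact: variance_copies. Qed.

Let M_large (r : R) : \forall a \near IE, r < a.1.
Proof.
apply: (@iterated_filter_fst R (fun M => r < M)).
by apply: nbhs_pinfty_gt; rewrite num_real.
Qed.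

Let sh_le a : 0 < a.1 -> sh a <= C / Num.sqrt a.1.
Proof. by move=> a0; apply: centering_shift_le. Qed.

Let C_sqrt_le (e : R) : 0 < e -> \forall a \near IE, C / Num.sqrt a.1 <= e.
Proof.
move=> e0; apply: filterS (M_large ((C / e) ^+ 2)) => a Ma.
have Ce : 0 < C / e by rewrite divr_gt0.
have s0 : C / e < Num.sqrt a.1.
  by rewrite -(ltr_pXn2r (n := 2)) ?nnegrE ?sqrtr_ge0 ?(ltW Ce) // sqr_sqrtr //
    (le_trans _ (ltW Ma)) // exprn_ge0 // ltW.
rewrite ler_pdivrMr; last exact: lt_trans s0.
by rewrite mulrC -ler_pdivrMr // ltW.
Qed.

Let C_div_le (e : R) : 0 < e -> \forall a \near IE, C / a.1 <= e.
Proof.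
move=> e0; apply: filterS (M_large (C / e)) => a Ma.
have Ce : 0 < C / e by rewrite divr_gt0.
by rewrite ler_pdivrMr ?(lt_trans Ce) // mulrC -ler_pdivrMr // ltW.
Qed.

(** On the light event Y is Z plus a nonnegative shift, so Y <= t forces Z <= t; the complement of
    the event costs C / M. *)
Let cdf_YZ a t : 0 < a.1 ->
  Prob (p a.2) (fun w => Y a w <= t) <= Prob (p a.2) (fun w => Z a.2 w <= t) + C / a.1.
Proof.
move=> a0; have P := Prob_light_event (p_small a.2) (@m_ge0 a.2) (@card_c a.2) a0 (var1 a.2).
apply: le_trans (lerD (lexx _) P); rewrite !ProbE -ExD; apply: (ler_Ex (p01 a.2)) => w.
have [le|nle] := boolP (light_event _ _ _ _ _); last first.
  by rewrite ler_wpDl // lern1 leq_b1.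
rewrite addr0 ler_nat; case: (leP (Y a w) t) => // Yt.
rewrite (le_trans _ Yt) // /Y /mu csum_light // lerDl.
exact: centering_shift_ge0.
Qed.

(** The one-sided bound Y <= Z + shift holds at every outcome, so this direction loses only the
    shift. *)
Let cdf_ZY a t b : 0 < a.1 -> sh a <= b ->
  Prob (p a.2) (fun w => Z a.2 w <= t) <= Prob (p a.2) (fun w => Y a w <= t + b).
Proof.
move=> a0 shb; apply: (ler_Prob (p01 a.2)) => w; rewrite !unfold_in /= => Zt.
by apply: le_trans (csum_light_le (p a.2) (c a.2) a.1 (@m_ge0 a.2) w) _; apply: lerD.
Qed.

Let Phi_near (t e : R) : 0 < e -> exists2 b : R, 0 < b &
  Phi (t + b) <= Phi t + e /\ Phi t - e <= Phi (t - b).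
Proof.
move=> e0; have P0 : 0 < normal_peak 1 :> R by rewrite normal_peak_gt0 // oner_eq0.
exists (e / normal_peak 1); first by rewrite divr_gt0.
have H x : `|Phi (x + e / normal_peak 1) - Phi x| <= e.
  apply: le_trans (Phi_lipschitz _ _) _.
  rewrite addrAC subrr add0r ger0_norm ?divr_ge0 ?(ltW e0) ?(ltW P0) //.
  by rewrite mulrC divfK ?gt_eqF.
have := H t; have := H (t - e / normal_peak 1); rewrite subrK !ler_norml.
by move=> /andP[? ?] /andP[? ?]; split; lra.
Qed.

Let cdf_Y_to_Z :
  (forall t, (fun a => Prob (p a.2) (fun w => Y a w <= t)) @ IE --> Phi t) ->
  forall t, (fun n => Prob (p n) (fun w => Z n w <= t)) @ \oo --> Phi t.
Proof.
move=> HY t; apply/cvgrPdist_le => e e0.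
suff : \forall a \near IE, `|Phi t - Prob (p a.2) (fun w => Z a.2 w <= t)| <= e.
  exact: (@iterated_filter_snd R (fun n => `|Phi t - Prob (p n) (fun w => Z n w <= t)| <= e)).1.
have e2 : 0 < e / 2 by rewrite divr_gt0.
have [b b0 [Pb _]] := Phi_near t e2.
have H1 : \forall a \near IE, `|Phi t - Prob (p a.2) (fun w => Y a w <= t)| <= e / 2.
  by move/cvgrPdist_le : (HY t); apply.
have H2 : \forall a \near IE, `|Phi (t + b) - Prob (p a.2) (fun w => Y a w <= t + b)| <= e / 2.
  by move/cvgrPdist_le : (HY (t + b)); apply.
near=> a.
have h1 : `|Phi t - Prob (p a.2) (fun w => Y a w <= t)| <= e / 2 by near: a.
have h2 : `|Phi (t + b) - Prob (p a.2) (fun w => Y a w <= t + b)| <= e / 2 by near: a.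
have h3 : C / a.1 <= e / 2 by near: a; apply: C_div_le.
have h4 : C / Num.sqrt a.1 <= b by near: a; apply: C_sqrt_le.
have h5 : 0 < a.1 by near: a; apply: M_large.
have u := cdf_YZ t h5; have v := cdf_ZY t h5 (le_trans (sh_le h5) h4).
move: h1 h2; rewrite !ler_norml => /andP[? ?] /andP[? ?]; apply/andP; split; lra.
Unshelve. all: by end_near. Qed.

Let cdf_Z_to_Y :
  (forall t, (fun n => Prob (p n) (fun w => Z n w <= t)) @ \oo --> Phi t) ->
  forall t, (fun a => Prob (p a.2) (fun w => Y a w <= t)) @ IE --> Phi t.
Proof.
move=> HZ t; apply/cvgrPdist_le => e e0.
have e2 : 0 < e / 2 by rewrite divr_gt0.
have [b b0 [_ Pb]] := Phi_near t e2.
have ZIE (x : R) : \forall a \near IE, `|Phi x - Prob (p a.2) (fun w => Z a.2 w <= x)| <= e / 2.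
  apply/(@iterated_filter_snd R (fun n => `|Phi x - Prob (p n) (fun w => Z n w <= x)| <= e / 2)).
  by move/cvgrPdist_le : (HZ x); apply.
near=> a.
have h1 : `|Phi t - Prob (p a.2) (fun w => Z a.2 w <= t)| <= e / 2 by near: a; apply: ZIE.
have h2 : `|Phi (t - b) - Prob (p a.2) (fun w => Z a.2 w <= t - b)| <= e / 2.
  by near: a; apply: ZIE.
have h3 : C / a.1 <= e / 2 by near: a; apply: C_div_le.
have h4 : C / Num.sqrt a.1 <= b by near: a; apply: C_sqrt_le.
have h5 : 0 < a.1 by near: a; apply: M_large.
have u := cdf_YZ t h5; have := cdf_ZY (t - b) h5 (le_trans (sh_le h5) h4).
rewrite subrK => v.
move: h1 h2; rewrite !ler_norml => /andP[? ?] /andP[? ?]; apply/andP; split; lra.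
Unshelve. all: by end_near. Qed.

(** The moment hypotheses send E Y^4 - 3 (E Y^2)^2 to 3 - 3 = 0. It dominates (1 - 7p) D, and 1 - 7p
    is at least 13/20, so D tends to 0 and [stein_bound] closes the argument. *)
Let stein_clt :
  (fun a => Ex (p a.2) (fun w => Y a w ^+ 2)) @ IE --> (1 : R) ->
  (fun a => Ex (p a.2) (fun w => Y a w ^+ 4)) @ IE --> (3 : R) ->
  forall t, (fun a => Prob (p a.2) (fun w => Y a w <= t)) @ IE --> Phi t.
Proof.
move=> H2 H4 t; pose D a := linked_mass (p a.2) (c a.2) (mu a).
have mu0 a s : 0 <= mu a s by apply: light_weight_ge0.
have D0 a : 0 <= D a by apply: linked_mass_ge0.
apply: (@stein_cvg R (R * nat)%type IE _ (fun a => N a.2) (fun a => p a.2) Y D) => //.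
  apply: filterS (M_large 0) => a a0 f f' L1 L2 b b0 L10 L20 hf' hf.
  apply: (stein_bound (p_small a.2) (mu0 a) b0 L10 L20 hf' hf).
  exact: variance_light_le1.
apply/cvgrPdist_le => e e0.
have K : (fun a => Ex (p a.2) (fun w => Y a w ^+ 4) -
    3 * (Ex (p a.2) (fun w => Y a w ^+ 2) * Ex (p a.2) (fun w => Y a w ^+ 2))) @ IE -->
    (3 - 3 * (1 * 1) : R).
  by apply: cvgB => //; apply: cvgMl_tmp; apply: cvgM.
have e2 : 0 < e / 2 by rewrite divr_gt0.
move/cvgrPdist_le : K => /(_ _ e2); apply: filterS => a.
have := linked_mass_le (c a.2) (p_small a.2) (mu0 a); rewrite -/(D a) /csum_var expr2.
set v := Ex _ _; set u := Ex _ _; rewrite sub0r normrN (ger0_norm (D0 a)) ler_norml.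
have := D0 a; case/andP: (p_small a.2) => p0 p1 d0 d1 /andP[d2 d3].
have : (13 / 20) * D a <= (1 - 7 * p a.2) * D a by rewrite ler_wpM2r //; lra.
by move: d1 d2; rewrite /v /u /Y; lra.
Qed.

(** For each fixed large M the shift is at most 1 and the sixth moment is bounded in n, so
    [fifth_moment_le] applies; how large n must be depends on M, which the iterated filter
    permits. *)
Let fifth_moment_Y :
  (forall t, (fun n => Prob (p n) (fun w => Z n w <= t)) @ \oo --> Phi t) ->
  \forall a \near IE, Ex (p a.2) (fun w => `|Y a w| ^+ 5) <= 2 * (16 * 10 + (8 ^+ 4 + 1) + 1).
Proof.
move=> HZ.
have : \forall M \near (+oo : set_system R), 0 < M /\ C / Num.sqrt M <= 1.
  near=> M.
  have CM : C ^+ 2 <= M by near: M; apply: nbhs_pinfty_ge; rewrite num_real.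
  have M0 : 0 < M by near: M; apply: nbhs_pinfty_gt; rewrite num_real.
  split=> //; rewrite ler_pdivrMr ?sqrtr_gt0 // mul1r.
  by rewrite -(ler_pXn2r (n := 2)) ?nnegrE ?sqrtr_ge0 ?(ltW C_gt0) // sqr_sqrtr // ltW.
rewrite /prop_near1 /iterated_filter /=; apply: filterS => M [M0 CM].
apply: (@fifth_moment_le R N p Z (fun n => Y (M, n))
  (moment_cst (2 ^+ (k * 6) * Num.sqrt M + 2) 6)) => //.
- move=> n w; apply: le_trans (csum_light_le (p n) (c n) M (@m_ge0 n) w) _.
  by rewrite lerD2l (le_trans _ CM) //; apply: (sh_le (a := (M, n))).
- by move=> n; apply: Ex_csum5_ge0 => // s; apply: light_weight_ge0.
- move=> n; apply: le_trans (ler_norm _) _.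
  exact: (Ex_csum_light_le (p_small n) (@m_ge0 n) (@card_c n) M0 (var1 n)).
Unshelve. all: by end_near. Qed.

Lemma clt_iff :
  (forall t : R, (fun n => Prob (p n) (fun w => Z n w <= t)) @ \oo --> Phi t) <->
  ((fun a => Ex (p a.2) (fun w => Y a w ^+ 2)) @ IE --> (1 : R) /\
   (fun a => Ex (p a.2) (fun w => Y a w ^+ 4)) @ IE --> (3 : R)).
Proof.
split=> [HZ|[H2 H4]]; last exact/cdf_Y_to_Z/stein_clt.
have HY := cdf_Z_to_Y HZ; have H5 := fifth_moment_Y HZ.
have p01' (a : R * nat) : 0 <= p a.2 <= 1 by [].
split.
- exact: (@moment_cvg R _ IE _ (fun a => N a.2) (fun a => p a.2) Y p01' HY 2 (@gauss2 R) 1 _ _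
    isT isT (@derive_gauss2 R) (@gauss2_lim R) H5).
- exact: (@moment_cvg R _ IE _ (fun a => N a.2) (fun a => p a.2) Y p01' HY 4 (@gauss4 R) 3 _ _
    isT isT (@derive_gauss4 R) (@gauss4_lim R) H5).
Qed.

End GraphSequence.

Theorem theorem2p11 (R : realType) (N : nat -> nat)
  (G : forall n : nat, rel 'I_(N n)) (k : nat) (eH : rel 'I_k) (p : nat -> R) :
  (forall n, simple_graph (G n)) ->
  simple_graph eH -> (0 < k)%N -> connected_graph eH ->
  (forall m : nat, exists n0 : nat, forall n, (n0 <= n)%N -> (m <= N n)%N) ->
  (forall n, 0 < p n <= 1 / 20) ->
  (forall n, 0 < VarT (G n) eH (p n)) ->
  ((forall t : R,
      (fun n => Prob (p n) (fun w => ZH (G n) eH (p n) w <= t)) @ \oo --> Phi t)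
   <->
   (limf_esup (fun M : R => limn_esup (fun n =>
        (`| Ex (p n) (fun w => ZM (G n) eH (p n) M w ^+ 2) - 1 |)%:E))
      (@pinfty_nbhs R) = 0%E
    /\
    limf_esup (fun M : R => limn_esup (fun n =>
        (`| Ex (p n) (fun w => ZM (G n) eH (p n) M w ^+ 4) - 3 |)%:E))
      (@pinfty_nbhs R) = 0%E)).
Proof.
move=> _ _ _ _ _ p_small var_gt0.
have mom (r : nat) (l : R) :
    limf_esup (fun M : R => limn_esup (fun n =>
        (`| Ex (p n) (fun w => ZM (G n) eH (p n) M w ^+ r) - l |)%:E))
      (@pinfty_nbhs R) = 0%E <->
    (fun a => Ex (p a.2) (fun w => csum (p a.2) (@image_set (N a.2) k)
      (light_weight (p a.2) (@image_set (N a.2) k) (copy_weight (G a.2) eH (p a.2)) a.1) w ^+ r))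
      @ @iterated_filter R --> l.
  have -> : (fun a : R * nat => Ex (p a.2) (fun w => csum (p a.2) (@image_set (N a.2) k)
      (light_weight (p a.2) (@image_set (N a.2) k) (copy_weight (G a.2) eH (p a.2)) a.1) w ^+ r)) =
    (fun a => Ex (p a.2) (fun w => ZM (G a.2) eH (p a.2) a.1 w ^+ r)).
    by apply/funext => a; apply: eq_Ex => w; rewrite ZME.
  rewrite (@iterated_limsup_eq0 R (fun M n => Ex (p n) (fun w => ZM (G n) eH (p n) M w ^+ r) - l)).
  exact: subr_cvg0.
rewrite !mom -(clt_iff p_small var_gt0).
have E t : (fun n => Prob (p n) (fun w => ZH (G n) eH (p n) w <= t)) = (fun n =>
    Prob (p n) (fun w => csum (p n) (@image_set (N n) k) (copy_weight (G n) eH (p n)) w <= t)).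
  by apply/funext => n; apply: eq_bigl => w; rewrite ZHE.
by split=> H t; [rewrite -E | rewrite E]; apply: H.
Qed.
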